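(* Consider the linear time-optimal control problem of the context, assume (A1)–(A4) of the context, let $\bar u(\cdot)$ be an optimal control with $\bar X=X^{\bar u}$, and let $\tau^{\bar u}<T$. Then for any $u\in U$ and a.e. $t\in[0,\tau^{\bar u}]$, $P$-a.s., $$\frac{\big[-p_0(t)^{\top}B+E_3^{\top}B+E_4^{\top}\big](u-\bar u(t))}{(E_1^{\top}+E_2^{\top}+E_3^{\top}A)\mathbb{E}[\bar X(\tau^{\bar u})]+(E_3^{\top}B+E_4^{\top})\mathbb{E}[\bar u(\tau^{\bar u})]}\le 0, \qquad(\ast)$$ where $p_0$ is the (deterministic) solution of $$\mathrm{d}p_0(t)^{\top}=\big[-p_0(t)^{\top}A+E_1^{\top}+E_2^{\top}+E_3^{\top}A\big]\mathrm{d}t,\qquad p_0(\tau^{\bar u})^{\top}=0,$$ that is, $$p_0(t)^{\top}=-\int_t^{\tau^{\bar u}}(E_1^{\top}+E_2^{\top}+E_3^{\top}A)e^{A(s-t)}\mathrm{d}s.$$ Furthermore, if $U$ is a bounded closed rectangle $U=[a_1,b_1]\times\dots\times[a_k,b_k]$ with $a_i\le b_i$, and $$(E_1^{\top}+E_2^{\top}+E_3^{\top}A)\mathbb{E}[\bar X(\tau^{\bar u})]+(E_3^{\top}B+E_4^{\top})\mathbb{E}[\bar u(\tau^{\bar u})]\ne0,$$ then $(\ast)$ implies that the optimal control $\bar u(t)=(\bar u_1(t),\dots,\bar u_k(t))$ is of bang-bang type in each component, except possibly on a set of singular times: for each $i=1,\dots,k$, for a.e. $t\in[0,\tau^{\bar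 u}]$ that is not a singular time for the $i$-th component, $\bar u_i(t)\in\{a_i,b_i\}$ $P$-a.s.
   Context: Setting. $(\Omega,\mathcal F,P;\{\mathcal F(t)\}_{t\ge0})$ is a complete filtered probability space, $W=(W_1,\dots,W_d)$ a $d$-dimensional standard Brownian motion and $\{\mathcal F(t)\}$ its $P$-augmented natural filtration. $T>0$, $x_0\in\mathbb{R}^m$, $y_0>0$, $U\subset\mathbb{R}^k$ convex. The set of controls $\mathcal U[0,T]$ consists of the $\{\mathcal F(t)\}$-adapted $U$-valued processes $u(\cdot)$ with $\mathbb{E}\int_0^T|u(t)|^2\mathrm{d}t<\infty$. Let $A\in\mathbb{R}^{m\times m}$, $B\in\mathbb{R}^{m\times k}$, $C_j\in\mathbb{R}^{m\times m}$, $D_j\in\mathbb{R}^{m\times k}$ ($1\le j\le d$) be constant matrices and $E_1,E_2,E_3\in\mathbb{R}^m$, $E_4\in\mathbb{R}^k$ constant vectors. For $u(\cdot)\in\mathcal U[0,T]$, $X^u$ and $Y^u$ solve on $[0,T]$ $$\mathrm{d}X^u(t)=[AX^u(t)+Bu(t)]\mathrm{d}t+\sum_{j=1}^d[C_jX^u(t)+D_ju(t)]\mathrm{d}W_j(t),\quad X^u(0)=x_0,$$ $$\mathrm{d}Y^u(t)=\big[E_1^{\top}\mathbb{E}[X^u(t)]+E_2^{\top}X^u(t)+E_3^{\top}\mathbb{E}[AX^u(t)+Bu(t)]+E_4^{\top}u(t)\big]\mathrm{d}t+g(\mathbb{E}[X^u(t)],X^u(t),u(t))\mathrm{d}W(t),\quad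 Y^u(0)=y_0,$$ where $g:\mathbb{R}^m\times\mathbb{R}^m\times U\to\mathbb{R}^{1\times d}$. Set $\tau^u=\inf\{t\in[0,T]:\mathbb{E}[Y^u(t)]\le0\}\wedge T$ (with $\inf\varnothing=+\infty$). The linear time-optimal control problem is to minimize $J(u(\cdot))=\tau^u$; $\bar u(\cdot)$ is optimal if $\tau^{\bar u}=\inf_{u(\cdot)\in\mathcal U[0,T]}\tau^u$. Write $b(x,u)=Ax+Bu$, $\sigma^j(x,u)=C_jx+D_ju$, $\sigma=(\sigma^1,\dots,\sigma^d)$, $h(x,x',x'',u)=E_1^{\top}x+E_2^{\top}x'+E_3^{\top}x''+E_4^{\top}u$, and $$G^u(t)=(E_1^{\top}+E_2^{\top}+E_3^{\top}A)\mathbb{E}[X^u(t)]+(E_3^{\top}B+E_4^{\top})\mathbb{E}[u(t)],$$ which is the expectation of the drift of $Y^u$ at time $t$. The functions $b,\sigma,h,g$ are uniformly continuous. Assumptions. (A1) There is $c>0$ with $|b(x_1,u)-b(x_2,u)|+|\sigma(x_1,u)-\sigma(x_2,u)|\le c|x_1-x_2|$ for all $x_1,x_2\in\mathbb{R}^m$, $u\in U$. (A2) There is $c>0$ with $|b(x,u)|+|\sigma(x,u)|\le c(1+|x|)$ and $|h(x,x',x'',u)|+|g(x,x',u)|\le c(1+|x|+|x'|+|x''|)$ for all $x,x',x''\in\mathbb{R}^m$, $u\in U$. (A3) $b,\sigma$ are differentiable with bounded derivatives; $h,g$ are differentiable with derivatives of linear growth. (A4) $\tau^{\bar u}$ is a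 Lebesgue point of $G^{\bar u}(\cdot)$ and $G^{\bar u}(\tau^{\bar u})\ne0$. Singular times. Define the switching function (row vector) $$S(t)=\frac{-p_0(t)^{\top}B+E_3^{\top}B+E_4^{\top}}{(E_1^{\top}+E_2^{\top}+E_3^{\top}A)\mathbb{E}[\bar X(\tau^{\bar u})]+(E_3^{\top}B+E_4^{\top})\mathbb{E}[\bar u(\tau^{\bar u})]}\in\mathbb{R}^{1\times k}.$$ A time $t\in[0,\tau^{\bar u}]$ is singular for the $i$-th component if $S_i(t)=0$. *)

(* Defs.v *)
From HB Require Import structures.
From mathcomp Require Import all_boot all_order all_algebra.
From mathcomp Require Import all_classical all_reals all_analysis.

Set Implicit Arguments.
Unset Strict Implicit.
Unset Printing Implicit Defensive.
Import Order.TTheory GRing.Theory Num.Theory.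
Import numFieldNormedType.Exports.
Local Open Scope classical_set_scope.
Local Open Scope ring_scope.

(* Norms: `|_| on matrices and on products is the library's max norm.  It only
   occurs in conditions that are invariant under a change of equivalent norm. *)

Section brownian.
Context {R : realType} {d0 : measure_display} {Omega : measurableType d0}.
Variables (P : probability Omega R) (d : nat) (W : 'I_d -> R -> Omega -> R).

Definition natural_gen (t : R) : set (set Omega) :=
  [set A | exists r j B, [/\ 0 <= r <= t, measurable B & A = W j r @^-1` B]].

Definition natural_filtration (t : R) : set (set Omega) := <<s natural_gen t >>.

Definition augmented_filtration (t : R) : set (set Omega) :=
  <<s natural_gen t `|` P.-negligible >>.

(* In the last clause A = Omega says that W(t) - W(s) is N(0, (t - s) I_d); a
   general A adds that it is independent of the past.  The second parameter of
   normal_prob is the standard deviation. *)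
Definition standard_brownian : Prop :=
  [/\ forall j t, 0 <= t -> measurable_fun [set: Omega] (W j t),
      forall j, {ae P, forall w, W j 0 w = 0},
      forall j, {ae P, forall w, {within `[0, +oo[, continuous (W j ^~ w)}} &
      forall s t, 0 <= s -> s < t ->
        forall A, natural_filtration s A ->
        forall B : 'I_d -> set R, (forall j, measurable (B j)) ->
        P (A `&` [set w | forall j, B j (W j t w - W j s w)]) =
        (P A * \prod_(j < d) normal_prob 0 (Num.sqrt (t - s)) (B j))%E].

End brownian.

Section ito.
Context {R : realType} {d0 : measure_display} {Omega : measurableType d0}.
Variables (P : probability Omega R) (F : R -> set (set Omega)) (T : R).

Definition measurable_wrt (G : set (set Omega)) (f : Omega -> R) : Prop :=
  forall B : set R, measurable B -> G (f @^-1` B).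

Definition adapted (f : R -> Omega -> R) : Prop :=
  forall t, t \in `[0, T] -> measurable_wrt (F t) (f t).

(* Joint measurability gives a meaning to E int_0^T |f(t)|^2 dt. *)
Definition L2_adapted (f : R -> Omega -> R) : Prop :=
  [/\ measurable_fun (`[0, T] `*` [set: Omega])
        (fun z : R * Omega => f z.1 z.2),
      adapted f &
      (\int[P]_w \int[lebesgue_measure]_(t in `[0%R, T]) ((f t w) ^+ 2)%:E < +oo)%E].

Record simple_process := SimpleProcess {
  sp_size : nat;
  sp_time : nat -> R;
  sp_coef : nat -> Omega -> R }.

Definition is_simple (phi : simple_process) : Prop :=
  [/\ {homo sp_time phi : i j / (i <= j)%N >-> i <= j},
      0 <= sp_time phi 0%N,
      sp_time phi (sp_size phi) <= T &
      forall i, (i < sp_size phi)%N ->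
        measurable_wrt (F (sp_time phi i)) (sp_coef phi i) /\
        exists M : R, forall w, `|sp_coef phi i w| <= M].

Definition simple_eval (phi : simple_process) (t : R) (w : Omega) : R :=
  \sum_(i < sp_size phi)
    sp_coef phi i w * (sp_time phi i < t <= sp_time phi i.+1)%R%:R.

Definition simple_integral (B : R -> Omega -> R) (phi : simple_process)
    (t : R) (w : Omega) : R :=
  \sum_(i < sp_size phi)
    sp_coef phi i w *
    (B (Num.min t (sp_time phi i.+1)) w - B (Num.min t (sp_time phi i)) w).

(* I(t) = int_0^t f dB for all t in [0, T]; determined up to modification. *)
Definition is_ito_integral (B f I : R -> Omega -> R) : Prop :=
  [/\ L2_adapted f, adapted I &
      exists phi : nat -> simple_process,
        [/\ forall n, is_simple (phi n),
            (fun n => \int[P]_w \int[lebesgue_measure]_(t in `[0%R, T])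
               ((simple_eval (phi n) t w - f t w) ^+ 2)%:E)%E @ \oo
              --> 0%E &
            forall t, t \in `[0, T] ->
            (fun n => \int[P]_w
               ((simple_integral B (phi n) t w - I t w) ^+ 2)%:E)%E @ \oo
              --> 0%E]].

(* dZ = a dt + sum_j s_j dW_j on [0, T], Z(0) = z0. *)
Definition is_ito_process (d : nat) (W : 'I_d -> R -> Omega -> R) (z0 : R)
    (a : R -> Omega -> R) (s : 'I_d -> R -> Omega -> R) (Z : R -> Omega -> R)
    : Prop :=
  [/\ L2_adapted Z,
      {ae P, forall w, {within `[0, T], continuous (Z ^~ w)}},
      {ae P, forall w,
         lebesgue_measure.-integrable `[0, T] (fun t => (a t w)%:E)} &
      exists I : 'I_d -> R -> Omega -> R,
        (forall j, is_ito_integral (W j) (s j) (I j)) /\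
        forall t, t \in `[0, T] -> {ae P, forall w,
          Z t w = z0 + Rintegral lebesgue_measure `[0, t] (a ^~ w)
                  + \sum_(j < d) I j t w}].

End ito.

Section calculus.
Context {R : realType}.

Definition unif_continuous_on (V V' : normedModType R) (D : set V)
    (f : V -> V') : Prop :=
  forall e : R, 0 < e -> exists2 r : R, 0 < r &
    forall x y, D x -> D y -> `|x - y| < r -> `|f x - f y| < e.

(* Frechet derivative relative to D: D need not be open. *)
Definition is_diff_on (V V' : normedModType R) (D : set V) (f : V -> V')
    (x : V) (L : {linear V -> V'}) : Prop :=
  forall e : R, 0 < e -> exists2 r : R, 0 < r &
    forall y, D y -> `|y - x| < r -> `|f y - f x - L (y - x)| <= e * `|y - x|.

Definition diff_with_bound (V V' : normedModType R) (D : set V) (f : V -> V')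
    (bnd : V -> R) : Prop :=
  forall x, D x -> exists2 L : {linear V -> V'},
    is_diff_on D f x L & forall v, `|L v| <= bnd x * `|v|.

Definition mexp (m : nat) (A : 'M[R]_m) : 'M[R]_m :=
  \matrix_(i, j) limn (series (fun n => (A ^+ n) i j / n`!%:R)).

End calculus.

Record problem (R : realType) (m k d : nat) := Problem {
  horizon : R;
  x0 : 'cV[R]_m;
  y0 : R;
  U : set 'cV[R]_k;
  cA : 'M[R]_m;
  cB : 'M[R]_(m, k);
  cC : 'I_d -> 'M[R]_m;
  cD : 'I_d -> 'M[R]_(m, k);
  E1 : 'cV[R]_m;
  E2 : 'cV[R]_m;
  E3 : 'cV[R]_m;
  E4 : 'cV[R]_k;
  (* only the values of g for a control argument in U matter *)
  g : 'cV[R]_m -> 'cV[R]_m -> 'cV[R]_k -> 'rV[R]_d }.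

Section coefficients.
Context {R : realType} {m k d : nat}.
Variable pb : problem R m k d.

Definition b (x : 'cV[R]_m) (u : 'cV[R]_k) : 'cV[R]_m :=
  cA pb *m x + cB pb *m u.

Definition sigma_col (j : 'I_d) (x : 'cV[R]_m) (u : 'cV[R]_k) : 'cV[R]_m :=
  cC pb j *m x + cD pb j *m u.

Definition sigma (x : 'cV[R]_m) (u : 'cV[R]_k) : 'M[R]_(m, d) :=
  \matrix_(i, j) sigma_col j x u i 0.

Definition h (x x' x'' : 'cV[R]_m) (u : 'cV[R]_k) : R :=
  ((E1 pb)^T *m x + (E2 pb)^T *m x' + (E3 pb)^T *m x'' + (E4 pb)^T *m u) 0 0.

Definition KX : 'rV[R]_m := (E1 pb)^T + (E2 pb)^T + (E3 pb)^T *m cA pb.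

Definition KU : 'rV[R]_k := (E3 pb)^T *m cB pb + (E4 pb)^T.

Let dom_xu : set ('cV[R]_m * 'cV[R]_k) := [set z | U pb z.2].
Let dom_xxu : set ('cV[R]_m * 'cV[R]_m * 'cV[R]_k) := [set z | U pb z.2].
Let dom_xxxu : set ('cV[R]_m * 'cV[R]_m * 'cV[R]_m * 'cV[R]_k) :=
  [set z | U pb z.2].

Let b_ (z : 'cV[R]_m * 'cV[R]_k) := b z.1 z.2.
Let sigma_ (z : 'cV[R]_m * 'cV[R]_k) := sigma z.1 z.2.
Let h_ (z : 'cV[R]_m * 'cV[R]_m * 'cV[R]_m * 'cV[R]_k) : R^o :=
  h z.1.1.1 z.1.1.2 z.1.2 z.2.
Let g_ (z : 'cV[R]_m * 'cV[R]_m * 'cV[R]_k) := g pb z.1.1 z.1.2 z.2.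

Definition standing : Prop :=
  [/\ 0 < horizon pb, 0 < y0 pb & @convex_set R 'cV[R]_k (U pb)] /\
  [/\ unif_continuous_on dom_xu b_, unif_continuous_on dom_xu sigma_,
      unif_continuous_on dom_xxxu h_ & unif_continuous_on dom_xxu g_].

Definition A1 : Prop := exists2 c : R, 0 < c & forall x1 x2 u, U pb u ->
  `|b x1 u - b x2 u| + `|sigma x1 u - sigma x2 u| <= c * `|x1 - x2|.

Definition A2 : Prop := exists2 c : R, 0 < c & forall x x' x'' u, U pb u ->
  `|b x u| + `|sigma x u| <= c * (1 + `|x|) /\
  `|h x x' x'' u| + `|g pb x x' u| <= c * (1 + `|x| + `|x'| + `|x''|).

Definition A3 : Prop := exists c : R,
  [/\ diff_with_bound dom_xu b_ (fun=> c),
      diff_with_bound dom_xu sigma_ (fun=> c),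
      diff_with_bound dom_xxxu h_ (fun z => c * (1 + `|z|)) &
      diff_with_bound dom_xxu g_ (fun z => c * (1 + `|z|))].

End coefficients.

Section control.
Context {R : realType} {m k d : nat} {d0 : measure_display}
  {Omega : measurableType d0}.
Variables (pb : problem R m k d) (P : probability Omega R)
  (W : 'I_d -> R -> Omega -> R).

Let F := augmented_filtration P W.
Let T := horizon pb.

(* entrywise expectation *)
Definition expect (p q : nat) (Z : Omega -> 'M[R]_(p, q)) : 'M[R]_(p, q) :=
  \matrix_(i, j) fine ('E_P[fun w => Z w i j])%E.

Definition control (u : R -> Omega -> 'cV[R]_k) : Prop :=
  (forall t w, t \in `[0, T] -> U pb (u t w)) /\
  forall i, L2_adapted P F T (fun t w => u t w i 0).

Definition state_eq (u : R -> Omega -> 'cV[R]_k) (X : R -> Omega -> 'cV[R]_m)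
    (Y : R -> Omega -> R) : Prop :=
  (forall i, is_ito_process P F T W (x0 pb i 0)
     (fun t w => b pb (X t w) (u t w) i 0)
     (fun j t w => sigma_col pb j (X t w) (u t w) i 0)
     (fun t w => X t w i 0)) /\
  is_ito_process P F T W (y0 pb)
    (fun t w => h pb (expect (X t)) (X t w)
                  (expect (fun w' => b pb (X t w') (u t w'))) (u t w))
    (fun j t w => g pb (expect (X t)) (X t w) (u t w) 0 j)
    Y.

(* The infimum is taken in \bar R, where ereal_inf set0 = +oo. *)
Definition tau (Y : R -> Omega -> R) : R :=
  fine (mine (ereal_inf [set t%:E | t in
                [set t | t \in `[0%R, T] /\ ('E_P[Y t] <= 0)%E]]) T%:E)%E.

Definition G (u : R -> Omega -> 'cV[R]_k) (X : R -> Omega -> 'cV[R]_m) (t : R)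
    : R :=
  (KX pb *m expect (X t) + KU pb *m expect (u t)) 0 0.

(* Y u is the state Y^u associated with the control u. *)
Definition optimal (Y : (R -> Omega -> 'cV[R]_k) -> R -> Omega -> R)
    (ubar : R -> Omega -> 'cV[R]_k) : Prop :=
  control ubar /\ tau (Y ubar) = inf [set tau (Y u) | u in control].

Definition A4 (u : R -> Omega -> 'cV[R]_k) (X : R -> Omega -> 'cV[R]_m)
    (Y : R -> Omega -> R) : Prop :=
  lebesgue_pt (G u X) (tau Y) /\ G u X (tau Y) != 0.

End control.

Section costate.
Context {R : realType} {m k d : nat}.
Variable pb : problem R m k d.

Definition costate (tf : R) (p : R -> 'cV[R]_m) : Prop :=
  [/\ forall i, {within `[0, tf], continuous (fun t => p t i 0)},
      forall t, t \in `]0, tf[ -> forall i,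
        is_derive t 1 (fun s => p s i 0)
          ((- ((p t)^T *m cA pb) + KX pb) 0 i) &
      p tf = 0].

Definition costate_formula (tf t : R) : 'rV[R]_m :=
  \row_j - Rintegral lebesgue_measure `[t, tf]
             (fun s => (KX pb *m mexp ((s - t) *: cA pb)) 0 j).

Definition switch_num (p : R -> 'cV[R]_m) (t : R) : 'rV[R]_k :=
  - ((p t)^T *m cB pb) + (E3 pb)^T *m cB pb + (E4 pb)^T.

(* den is the value of G at the optimal time. *)
Definition switching (den : R) (p : R -> 'cV[R]_m) (t : R) : 'rV[R]_k :=
  den^-1 *: switch_num p t.

Definition singular_time (den : R) (p : R -> 'cV[R]_m) (i : 'I_k) (t : R)
    : Prop :=
  switching den p t 0 i = 0.

End costate.

Definition rectangle (R : realType) (k : nat) (lo hi : 'cV[R]_k)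
    : set 'cV[R]_k :=
  [set u | forall i, lo i 0 <= u i 0 <= hi i 0].

(* Main.v *)
Require Import Defs.
From HB Require Import structures.
From mathcomp Require Import all_boot all_order all_algebra.
From mathcomp Require Import all_classical all_reals all_analysis.
From mathcomp Require Import measurable_realfun ring lra.
Set Implicit Arguments.
Unset Strict Implicit.
Unset Printing Implicit Defensive.
Import Order.TTheory GRing.Theory Num.Theory.
Import numFieldNormedType.Exports.
Local Open Scope classical_set_scope.
Local Open Scope ring_scope.

(* Ito integrals have mean zero, so t |-> E[X(t)] solves a linear ODE driven by
   E[u(t)], and E[Y(t)] = y0 + int_0^t G.  Integrating the costate against this
   ODE gives, for every control u and with s = switch_num p0,
     E[Y^u(tf)] = y0 - p0(0)^T x0 + int_0^tf s(t) E[u(t)] dt.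
   If ubar is optimal with tf < T, then E[Y^ubar(tf)] = 0, and E[Y^v(tf)] < 0 is
   impossible for any control v, since E[Y^v] would vanish before tf by
   continuity.  So ubar minimizes int_0^tf s(t) E[u(t)] dt.  Comparing it with
   the control equal to the constant u where s(t)(u - ubar(t)) < 0 and to ubar
   elsewhere shows s(t)(u - ubar(t)) >= 0 almost everywhere.  As E[Y^ubar] > 0
   before tf, its derivative den at the Lebesgue point tf is nonpositive, hence
   negative by (A4), and dividing by it gives the inequality.  On a rectangle,
   the inequality at the corner maximizing the linear form forces each
   nonsingular component of ubar to an end point. *)

(** * Centered normal variables *)

(** The mean of the output is affine in the control, so the comparison with a competitor is exact:
    the control may be changed on a large set, and no small variation or expansion of the state
    appears. The competitor may depend on the sample; it stays adapted because [switch_num] is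
    deterministic and the decision at time [t] looks only at [u t w]. Two obstacles shape the rest.
    A square-integrable control is known to have a finite mean only at almost every time, so
    identities between means are kept almost everywhere or under a time integral, and the pairing
    with the costate is integrated by parts through Fubini instead of differentiating the mean of
    [X]. Ito integrals are given only as L2 limits of simple integrals, and increments only as
    independent of the unaugmented filtration, so mean zero is built up from the normal law of one
    increment, null events being added on the way. The null set of times in the inequality depends
    on the point [u]. On a rectangle the relevant point varies with [t], but only among finitely
    many corners, so one null set serves them all. *)

Section normal_mean.
Context {R : realType}.
Notation mu := (@lebesgue_measure R).

(** The Radon-Nikodym derivative of [normal_prob] agrees with [normal_pdf] almost everywhere,
    because both integrate to the same value over every measurable set. *)
Lemma ge0_integral_normal_prob (m s : R) (f : R -> \bar R) :
  (forall x, (0 <= f x)%E) -> measurable_fun [set: R] f ->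
  (\int[normal_prob m s]_x f x = \int[mu]_x (f x * (normal_pdf m s x)%:E))%E.
Proof.
move=> f0 mf; have dom := normal_prob_dominates m s.
rewrite -(Radon_Nikodym_SigmaFinite.change_of_variables dom)//.
have mpdf : measurable_fun [set: R] (fun x => (normal_pdf m s x)%:E).
  by apply/measurable_EFinP; exact: measurable_normal_pdf.
have mRN : measurable_fun [set: R]
    (Radon_Nikodym_SigmaFinite.f (normal_prob m s) mu).
  exact: measurable_int (Radon_Nikodym_SigmaFinite.f_integrable dom).
apply: ge0_ae_eq_integral => //.
- exact: emeasurable_funM.
- exact: emeasurable_funM.
- by move=> x _; rewrite mule_ge0//; exact: Radon_Nikodym_SigmaFinite.f_ge0.
- by move=> x _; rewrite mule_ge0// lee_fin normal_pdf_ge0.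
apply: ae_eqe_mul2l; apply: integral_ae_eq => //=.
- exact: Radon_Nikodym_SigmaFinite.f_integrable.
- by move=> A _ mA; rewrite -Radon_Nikodym_SigmaFinite.f_integral.
Qed.

(** Since [f] vanishes for negative arguments, both integrals reduce to half-lines, which the
    substitution by [- x] exchanges. The intended [f] is the positive part of [x] times a centered
    density. *)
Lemma integral_reflection (f : R -> R) : (forall x, 0 <= f x) -> continuous f ->
  (forall x, x <= 0 -> f x = 0) ->
  (\int[mu]_x (f (- x))%:E = \int[mu]_x (f x)%:E)%E.
Proof.
move=> f0 cf f_neg.
have cfN : continuous (f \o -%R).
  by move=> x; apply: continuous_comp; [exact: opp_continuous|exact: cf].
have -> : (\int[mu]_x (f x)%:E = \int[mu]_(x in `[0%R, +oo[) (f x)%:E)%E.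
  rewrite [RHS]integral_mkcond; apply: eq_integral => x _.
  rewrite patchE; case: ifPn => // /negP; rewrite inE/= in_itv/= andbT.
  by move=> /negP; rewrite -ltNge => /ltW/f_neg->.
have -> : (\int[mu]_x (f (- x))%:E =
    \int[mu]_(x in `]-oo, (- 0)%R]) ((f \o -%R) x)%:E)%E.
  rewrite [RHS]integral_mkcond; apply: eq_integral => x _.
  rewrite patchE; case: ifPn => // /negP; rewrite inE/= in_itv/= oppr0.
  by move=> /negP; rewrite -ltNge => /ltW x0; rewrite f_neg// oppr_le0.
rewrite ge0_integration_by_substitutionNy//; last first.
  by move=> x _; rewrite /= f0.
  exact: continuous_subspaceT.
by apply: eq_integral => x _; rewrite /= opprK.
Qed.

(* With [y = x ^+ 2 / (4 * s ^+ 2)], AM-GM gives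
   [`|x| <= s * (1 + y) <= s * expR y]; the factor [expR y] doubles the variance. *)
Lemma ler_norm_normal_pdf (s : R) : 0 < s -> exists C : R, forall x,
  `|x| * normal_pdf 0 s x <= C * normal_pdf 0 (Num.sqrt 2 * s) x.
Proof.
move=> s0; have s2 : Num.sqrt 2 * s != 0 :> R.
  by rewrite mulf_neq0// ?gt_eqF// sqrtr_gt0.
exists (normal_peak s * s / normal_peak (Num.sqrt 2 * s)) => x.
rewrite normal_pdfE ?gt_eqF// (normal_pdfE _ s2).
rewrite [leRHS]mulrA divfK ?gt_eqF ?normal_peak_gt0//.
rewrite mulrCA -mulrA ler_wpM2l ?normal_peak_ge0//.
rewrite /normal_fun !subr0 exprMn sqr_sqrtr// [2 * _]mulr_natl.
set y := x ^+ 2 / (s ^+ 2 *+ 2 *+ 2).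
have -> : - x ^+ 2 / (s ^+ 2 *+ 2) = - (y + y).
  by rewrite /y; field; rewrite gt_eqF.
rewrite mulNr -/y opprD expRD mulrA ler_wpM2r ?expR_ge0//.
rewrite expRN ler_pdivrMr ?expR_gt0//.
apply: (@le_trans _ _ (s * (1 + y))); last first.
  by rewrite ler_wpM2l ?(ltW s0) ?expR_ge1Dx.
have -> : s * (1 + y) = `|x| + s * (1 - `|x| / (s *+ 2)) ^+ 2.
  rewrite /y -(real_normK (num_real x)); field; by rewrite gt_eqF.
by rewrite lerDl mulr_ge0// ?sqr_ge0// ltW.
Qed.

Lemma integrable_normal_prob_id (s : R) : 0 < s ->
  (normal_prob 0 s).-integrable setT EFin.
Proof.
move=> s0; apply/integrableP; split; first exact/measurable_EFinP.
rewrite ge0_integral_normal_prob//; last exact: measurableT_comp.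
have [C hC] := ler_norm_normal_pdf s0.
apply: (@le_lt_trans _ _
  (\int[mu]_x (C%:E * (normal_pdf 0 (Num.sqrt 2 * s) x)%:E))%E).
  apply: ge0_le_integral => //=.
  - by move=> x _; rewrite mule_ge0// lee_fin normal_pdf_ge0.
  - apply: emeasurable_funM; first exact: measurableT_comp.
    by apply/measurable_EFinP; exact: measurable_normal_pdf.
  - apply: measurable_funeM.
    by apply/measurable_EFinP; exact: measurable_normal_pdf.
  - by move=> x _; rewrite -!EFinM lee_fin.
by rewrite integralZl//= ?integral_normal_pdf ?mule1 ?ltry//;
  exact: integrable_normal_pdf.
Qed.

Lemma integral_normal_prob_id (s : R) : 0 < s ->
  (\int[normal_prob 0 s]_x x%:E = 0)%E.
Proof.
move=> s0; have s_neq0 : s != 0 by rewrite gt_eqF.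
have [mid iid] := integrableP _ _ _ (integrable_normal_prob_id s0).
rewrite integralE !ge0_integral_normal_prob//;
  [|exact: measurable_funeneg|exact: measurable_funepos].
pose f (x : R) := Num.max x 0 * normal_pdf 0 s x.
have pdfN x : normal_pdf 0 s (- x) = normal_pdf 0 s x.
  by rewrite normal_pdfE//= /normal_fun !subr0 sqrrN.
have -> : (\int[mu]_x (EFin^\- x * (normal_pdf 0 s x)%:E) =
    \int[mu]_x (f (- x))%:E)%E.
  apply: eq_integral => x _; rewrite /f pdfN EFinM funenegE -EFinN.
  by rewrite -EFin_max.
have -> : (\int[mu]_x (EFin^\+ x * (normal_pdf 0 s x)%:E) =
    \int[mu]_x (f x)%:E)%E.
  by apply: eq_integral => x _; rewrite /f EFinM funeposE -EFin_max.
have f_ge0 x : 0 <= f x by rewrite mulr_ge0 ?normal_pdf_ge0// le_max lexx orbT.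
rewrite integral_reflection//; last 2 first.
- move=> x; apply: cvgM; last exact: continuous_normal_pdf.
  by apply: continuous_max; [exact: cvg_id|exact: cvg_cst].
- by move=> x x0; rewrite /f max_r// mul0r.
rewrite subee//.
(* Equal extended reals cancel only if finite; finiteness comes from the absolute first moment
   [iid]. *)
rewrite ge0_fin_numE ?integral_ge0//; last by move=> x _; rewrite lee_fin.
move: iid; rewrite ge0_integral_normal_prob//; last exact: measurableT_comp.
apply: le_lt_trans; apply: ge0_le_integral => //=.
- by move=> x _; rewrite lee_fin.
- apply/measurable_EFinP; apply: measurable_funM.
    exact: measurable_maxr.
  exact: measurable_normal_pdf.
- apply: emeasurable_funM; first exact: measurableT_comp.
  by apply/measurable_EFinP; exact: measurable_normal_pdf.
- move=> x _; rewrite -EFinM lee_fin ler_wpM2r ?normal_pdf_ge0//.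
  by rewrite ge_max ler_norm normr_ge0.
Qed.

End normal_mean.

(** * Products with an independent centered factor *)

Section independent_centered_factor.
Context {R : realType} {d0 : measure_display} {Omega : measurableType d0}.
Variable P : probability Omega R.

(** The sum counts the positive integers up to [y], so it is the integer part of [y], written as a
    finite sum of indicators to which independence on events applies. *)
Lemma ler_norm_sum_steps (K : nat) (y : R) : 0 <= y <= K%:R ->
  `|\sum_(k < K) (k.+1%:R <= y)%R%:R - y| <= 1.
Proof.
elim: K y => [|K IH] y /andP[y0 yK].
  by rewrite big_ord0 sub0r normrN ger0_norm// (le_trans yK).
rewrite big_ord_recr/=; have [yK'|Ky] := leP y K%:R.
  rewrite [(K.+1%:R <= y)]leNgt (le_lt_trans yK') ?ltr_nat//= addr0.
  by rewrite IH// y0.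
rewrite (eq_bigr (fun=> 1)) => [|k _]; last first.
  by rewrite (le_trans _ (ltW Ky))// ler_nat.
rewrite sumr_const card_ord -natr1 in yK *.
by rewrite ler_norml; case: (leP (K%:R + 1) y) => /= ?; apply/andP; split; lra.
Qed.

Variables (G : set (set Omega)) (D : Omega -> R)
  (nu : probability (measurableTypeR R) R).
Hypothesis G_measurable : forall A, G A -> measurable A.
Hypothesis G_setT : G setT.
Hypothesis D_measurable : measurable_fun [set: Omega] D.
Hypothesis GD_indep : forall A B, G A -> measurable B ->
  (P (A `&` D @^-1` B) = P A * nu B)%E.
Hypothesis nu_integrable : nu.-integrable setT EFin.
Hypothesis nu_mean0 : (\int[nu]_x x%:E = 0)%E.

(** By [GD_indep], the image under [D] of [P] restricted to [A] is [P A] times [nu], so this is a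
    change of variables. The case [A = setT] says that [nu] is the law of [D]. *)
Lemma ge0_integral_indep (A : set Omega) (f : R -> \bar R) : G A ->
  (forall x, (0 <= f x)%E) -> measurable_fun [set: R] f ->
  (\int[P]_(w in A) f (D w) = P A * \int[nu]_x f x)%E.
Proof.
move=> GA f0 mf; have mA := G_measurable GA.
have [M PA] : {M : {nonneg R} | P A = M%:num%:E}.
  have /fineK PA : P A \is a fin_num by rewrite fin_num_measure.
  by exists (NngNum (fine_ge0 (measure_ge0 P A))) => /=; rewrite PA.
transitivity (\int[mrestr P mA]_w f (D w))%E.
  have mAc : measurable (~` A) by exact: measurableC.
  have -> : (\int[mrestr P mA]_w f (D w) = \int[mrestr P mA]_(w in A) f (D w))%E.
    rewrite (@ge0_negligible_integral _ _ _ _ _ (~` A))//; first last.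
    - by rewrite -[LHS]/(P (~` A `&` A)) setICl measure0.
    - exact: measurableT_comp.
    by rewrite setTD setCK.
  apply: eq_measure_integral => B mB BA.
  by rewrite -[RHS]/(P (B `&` A)) (setIidl BA).
pose D' : Omega -> measurableTypeR R := D.
have mD' : measurable_fun [set: Omega] D' by exact: D_measurable.
transitivity (\int[pushforward (mrestr P mA) D']_x f x)%E.
  by rewrite (ge0_integral_pushforward mD')// preimage_setT.
rewrite PA -ge0_integral_mscale//; apply: eq_measure_integral => /= B mB _.
by rewrite /pushforward /mscale/= /mrestr setIC GD_indep// PA.
Qed.

Lemma integrable_indep : P.-integrable setT (EFin \o D).
Proof.
apply/integrableP; split; first exact/measurable_EFinP.
rewrite (ge0_integral_indep G_setT (f := fun x => `|x%:E|%E))//; last first.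
  exact: measurableT_comp.
by have [_] := integrableP _ _ _ nu_integrable; rewrite probability_setT mul1e.
Qed.

Lemma integral_indep0 (A : set Omega) : G A ->
  (\int[P]_(w in A) (D w)%:E = 0)%E.
Proof.
move=> GA; have mA := G_measurable GA.
rewrite integralE.
have -> : (\int[P]_(w in A) (EFin \o D)^\+ w = P A * \int[nu]_x EFin^\+ x)%E.
  rewrite -ge0_integral_indep//; last exact: measurable_funepos.
  by rewrite funepos_comp.
have -> : (\int[P]_(w in A) (fun w => (D w)%:E)^\- w =
    P A * \int[nu]_x EFin^\- x)%E.
  rewrite -ge0_integral_indep//; last exact: measurable_funeneg.
  by rewrite -[LHS]/(\int[P]_(w in A) (EFin \o D)^\- w)%E funeneg_comp.
rewrite -muleBr ?fin_num_measure//; last first.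
  exact: integrable_add_def.
by rewrite -integralE nu_mean0 mule0.
Qed.

(* Step functions of [xi + M] with [n] steps per unit length give the bound
   E|D| / n for every n. *)
Lemma integral_bounded_indep0 (xi : Omega -> R) (M : R) :
  measurable_wrt G xi -> (forall w, `|xi w| <= M) ->
  P.-integrable setT (fun w => (xi w * D w)%:E) /\
  (\int[P]_w (xi w * D w)%:E = 0)%E.
Proof.
move=> Gxi xiM.
have iD := integrable_indep.
have mxi : measurable_fun [set: Omega] xi.
  by move=> _ B mB; rewrite setTI; exact: G_measurable (Gxi _ mB).
have bounded_int (f : Omega -> R) (C : R) : measurable_fun [set: Omega] f ->
    (forall w, `|f w| <= C) -> P.-integrable setT (fun w => (f w * D w)%:E).
  move=> mf fC.
  apply: (@le_integrable _ _ _ P _ _ _ (fun w => C%:E * (D w)%:E)%E).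
  - by [].
  - by apply/measurable_EFinP; apply: measurable_funM.
  - move=> w _; rewrite -EFinM !abse_EFin lee_fin !normrM ler_wpM2r//.
    by rewrite (le_trans (fC w))// ler_norm.
  - exact: integrableZl.
split; first exact: bounded_int xiM.
pose c := fine (\int[P]_w `|(D w)%:E|).
have M0 : 0 <= M by have w := point : Omega; rewrite (le_trans _ (xiM w)).
(* Steps are counted from 0, so the factor is made nonnegative first; the shift contributes [M]
   times the mean of [D], which is 0. *)
pose zeta w := xi w + M.
have zeta_itv w : 0 <= zeta w <= 2 * M.
  by have := xiM w; rewrite /zeta ler_norml => /andP[]; lra.
have mzeta : measurable_fun [set: Omega] zeta by exact: measurable_funD.
have zetaM w : `|zeta w| <= 2 * M.
  by have /andP[z0 zM] := zeta_itv w; rewrite ger0_norm.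
have izeta := bounded_int _ _ mzeta zetaM.
have D0 : (\int[P]_w (D w)%:E = 0)%E by exact: integral_indep0.
suff zeta0 : (\int[P]_w (zeta w * D w)%:E = 0)%E.
  transitivity (\int[P]_w ((zeta w * D w)%:E - M%:E * (D w)%:E))%E.
    by apply: eq_integral => w _; rewrite -EFinM -EFinB /zeta mulrDl addrK.
  rewrite integralB//; last exact: integrableZl.
  by rewrite zeta0 integralZl// D0 mule0 subee.
have bound (n : nat) : (`|\int[P]_w (zeta w * D w)%:E| * n%:R%:E <= c%:E)%E.
  (* As [n%:R * zeta w] is at most [n%:R * (2 * M)], this many levels reach every value. *)
  pose K := (Num.truncn (n%:R * (2 * M))).+1.
  pose step w : R := \sum_(k < K) (k.+1%:R <= n%:R * zeta w)%R%:R.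
  have mset k : G [set w | k.+1%:R <= n%:R * zeta w].
    have -> : [set w | k.+1%:R <= n%:R * zeta w] =
        xi @^-1` ((fun x => n%:R * (x + M)) @^-1` `[k.+1%:R, +oo[).
      by apply/seteqP; split=> w /=; rewrite in_itv/= andbT.
    apply: Gxi; rewrite -[X in measurable X]setTI.
    have : measurable_fun [set: R] (fun x : R => n%:R * (x + M)).
      by apply: measurable_funM => //; exact: measurable_funD.
    by apply.
  have stepE w : step w = \sum_(k < K) \1_[set w | k.+1%:R <= n%:R * zeta w] w.
    apply: eq_bigr => k _; rewrite indicE; congr (_%:R); congr nat_of_bool.
    by apply/idP/idP; rewrite inE.
  have mstep : measurable_fun [set: Omega] step.
    rewrite (funext stepE).
    by apply: measurable_sum => k; apply: measurable_indic; exact: G_measurable.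
  have step_close w : `|n%:R * zeta w - step w| <= 1.
    rewrite distrC; apply: ler_norm_sum_steps.
    have /andP[z0 zM] := zeta_itv w; rewrite mulr_ge0//=.
    rewrite (@le_trans _ _ (n%:R * (2 * M)))// ?ler_wpM2l//.
    by rewrite ltW// truncnS_gt.
  have ierr : P.-integrable setT (fun w => ((n%:R * zeta w - step w) * D w)%:E).
    apply: (@bounded_int _ 1) => //.
    by apply: measurable_funB => //; exact: measurable_funM.
  have istep : P.-integrable setT (fun w => (step w * D w)%:E).
    apply: (@bounded_int _ (n%:R * (2 * M) + 1)) => // w.
    have := step_close w; have /andP[z0 zM] := zeta_itv w.
    have : n%:R * zeta w <= n%:R * (2 * M) by rewrite ler_wpM2l.
    have : 0 <= n%:R * zeta w by rewrite mulr_ge0.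
    by rewrite !ler_norml; lra.
  have step0 : (\int[P]_w (step w * D w)%:E = 0)%E.
    transitivity (\int[P]_w
        \sum_(k < K) (\1_[set w | k.+1%:R <= n%:R * zeta w]%R w * D w)%:E)%E.
      apply: eq_integral => w _; rewrite sumEFin; congr EFin.
      by rewrite stepE mulr_suml.
    rewrite integral_sum//; last first.
      move=> k; apply: (@bounded_int _ 1) => [|w].
        by apply: measurable_indic; exact: G_measurable.
      by rewrite indicE; case: (_ \in _); rewrite ?normr1 ?normr0.
    rewrite big1// => k _; rewrite -[RHS](integral_indep0 (mset k)).
    rewrite [RHS]integral_mkcond; apply: eq_integral => w _.
    by rewrite patchE indicE; case: (_ \in _); rewrite ?mul1r ?mul0r.
  have -> : (`|\int[P]_w (zeta w * D w)%:E| * n%:R%:E =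
      `|\int[P]_w ((n%:R * zeta w - step w) * D w)%:E|)%E.
    have -> : (\int[P]_w ((n%:R * zeta w - step w) * D w)%:E =
        \int[P]_w (n%:R%:E * (zeta w * D w)%:E - (step w * D w)%:E))%E.
      by apply: eq_integral => w _; rewrite -EFinM -EFinB mulrBl mulrA.
    rewrite integralB//; last exact: integrableZl.
    by rewrite step0 sube0 integralZl// abseM muleC abse_EFin ger0_norm.
  apply: (le_trans (le_abse_integral _ _ (measurable_int _ ierr))) => //.
  rewrite /c fineK; last first.
    by apply: integrable_fin_num => //; exact: integrable_abse.
  apply: ge0_le_integral => //.
  - by apply: measurableT_comp => //; exact: (measurable_int _ ierr).
  - by apply: measurableT_comp => //; exact: (measurable_int _ iD).
  - by move=> w _; rewrite !abse_EFin lee_fin normrM ler_piMl.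
have /fineK zE : (\int[P]_w (zeta w * D w)%:E)%E \is a fin_num.
  exact: integrable_fin_num.
move: bound; rewrite -zE => bound; congr EFin; apply/eqP.
rewrite -normr_le0 leNgt; apply/negP => z0.
set z := `|_| in z0.
(* An integer larger than [c / z] contradicts the bound. *)
have := bound (Num.truncn (c / z)).+1.
rewrite abse_EFin -EFinM lee_fin leNgt => /negP; apply.
by rewrite -ltr_pdivrMl// mulrC truncnS_gt.
Qed.

End independent_centered_factor.

(** * Means of Ito integrals *)

Section brownian_filtration.
Context {R : realType} {d0 : measure_display} {Omega : measurableType d0}.
Variables (P : probability Omega R) (d : nat) (W : 'I_d -> R -> Omega -> R).
Hypothesis P_complete : measure_is_complete P.
Hypothesis W_brownian : standard_brownian P W.

Lemma natural_filtration_measurable (t : R) (A : set Omega) :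
  natural_filtration W t A -> measurable A.
Proof.
have [mW _ _ _] := W_brownian.
apply: (smallest_sub (sigma_algebra_measurable Omega)).
move=> _ [r [j [B [/andP[r0 _] mB ->]]]].
by rewrite -[X in measurable X]setTI; exact: mW.
Qed.

(** Completeness of [P] makes the negligible generators measurable. *)
Lemma augmented_filtration_measurable (t : R) (A : set Omega) :
  augmented_filtration P W t A -> measurable A.
Proof.
apply: (smallest_sub (sigma_algebra_measurable Omega)) => B [Bnat|].
  by apply: (@natural_filtration_measurable t); exact: sub_sigma_algebra.
exact: P_complete.
Qed.

(** The sets that differ from some natural event by a negligible set form a sigma-algebra containing
    both kinds of generators. This carries the independence of increments, assumed for natural
    events, over to the augmented filtration. *)
Lemma augmented_filtrationP (t : R) (A : set Omega) :
  augmented_filtration P W t A ->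
  exists2 A', natural_filtration W t A' & P.-negligible (A `+` A').
Proof.
pose nat_alg := sigma_algebra_measurable
  (g_sigma_algebraType (natural_gen W t)).
have [nat0 natC natU] : sigma_algebra setT (natural_filtration W t) := nat_alg.
pose C := [set B | exists2 B', natural_filtration W t B' &
  P.-negligible (B `+` B')].
apply: (@smallest_sub _ (sigma_algebra setT) _ C) =>
  [|B [Bnat|Bneg]]; last 2 first.
- exists B; first exact: sub_sigma_algebra.
  by rewrite setYK; exact: negligible_set0.
- by exists set0 => //; rewrite setY0.
split.
- by exists set0 => //; rewrite setYK; exact: negligible_set0.
- move=> B [B' natB' BB']; exists (setT `\` B'); first exact: natC.
  have -> : setT `\` B `+` (setT `\` B') = B `+` B' => //.
  by apply/seteqP; split=> w; rewrite /setY/=;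
    have [] := pselect (B w); have [] := pselect (B' w); tauto.
- move=> B hB.
  have /choice[B' hB'] : forall n, exists B', natural_filtration W t B' /\
      P.-negligible (B n `+` B').
    by move=> n; have [B' ? ?] := hB n; exists B'.
  exists (\bigcup_n B' n); first by apply: natU => n; have [] := hB' n.
  have /negligible_bigcup : forall n, P.-negligible (B n `+` B' n).
    by move=> n; have [] := hB' n.
  apply: negligibleS => w [[[n _ Bn] nB']|[[n _ Bn] nB']].
    by exists n => //; left; split=> // B'n; apply: nB'; exists n.
  by exists n => //; right; split=> // B'n; apply: nB'; exists n.
Qed.

Lemma measure_negligible_setY (A B : set Omega) : measurable A -> measurable B ->
  P.-negligible (A `+` B) -> P A = P B.
Proof.
move=> mA mB nAB; have mAB : measurable (A `+` B).
  by apply: measurableU; exact: measurableD.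
have AB0 := measure_negligible mAB nAB.
apply/eqP; rewrite eq_le; apply/andP; split.
  rewrite (@le_trans _ _ (P (B `|` (A `+` B))))//.
    apply: le_measure; rewrite ?inE//; first exact: measurableU.
    by move=> w Aw; have [Bw|nBw] := pselect (B w); [left|right; left].
  by rewrite (le_trans (measureU2 _ _ _))// AB0 adde0.
rewrite (@le_trans _ _ (P (A `|` (A `+` B))))//.
  apply: le_measure; rewrite ?inE//; first exact: measurableU.
  by move=> w Bw; have [Aw|nAw] := pselect (A w); [left|right; right].
by rewrite (le_trans (measureU2 _ _ _))// AB0 adde0.
Qed.

Lemma measurable_brownian_increment (j : 'I_d) (s t : R) : 0 <= s -> 0 <= t ->
  measurable_fun [set: Omega] (fun w => W j t w - W j s w).
Proof.
by have [mW _ _ _] := W_brownian => s0 t0; apply: measurable_funB; exact: mW.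
Qed.

Lemma brownian_increment_indep (j : 'I_d) (s t : R) (A : set Omega)
    (B : set R) : 0 <= s -> s < t -> augmented_filtration P W s A ->
  measurable B ->
  (P (A `&` (fun w => W j t w - W j s w)%R @^-1` B) =
   P A * normal_prob 0 (Num.sqrt (t - s)) B)%E.
Proof.
move=> s0 st FA mB; have [A' natA' AA'] := augmented_filtrationP FA.
have mA := augmented_filtration_measurable FA.
have mA' := natural_filtration_measurable natA'.
set D := _ @^-1` B.
have mD : measurable D.
  rewrite -[X in measurable X]setTI.
  by apply: measurable_brownian_increment => //; rewrite ltW// (le_lt_trans s0).
rewrite (measure_negligible_setY mA mA' AA').
rewrite (@measure_negligible_setY _ (A' `&` D)).
- have [_ _ _ /(_ _ _ s0 st _ natA')] := W_brownian.
  (* Only component [j] is constrained; the other factors of the product are total masses, equal to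
     1. *)
  pose Bj i : set R := if i == j then B else setT.
  have mBj i : measurable (Bj i) by rewrite /Bj; case: ifP.
  move=> /(_ _ mBj); rewrite (bigD1 j)//= big1 ?mule1; last first.
    by move=> i ij; rewrite /Bj (negbTE ij) probability_setT.
  rewrite {2}/Bj eqxx => <-; congr (P (_ `&` _)); apply/seteqP; split=> w /=.
    by move=> Dw i; rewrite /Bj; case: eqP => // ->.
  by move=> /(_ j); rewrite /Bj eqxx.
- exact: measurableI.
- exact: measurableI.
- apply: negligibleS AA' => w; rewrite /setY/=; tauto.
Qed.

Lemma expectation_brownian_increment0 (j : 'I_d) (s t : R) (xi : Omega -> R)
    (M : R) : 0 <= s -> s <= t ->
  measurable_wrt (augmented_filtration P W s) xi ->
  (forall w, `|xi w| <= M) ->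
  P.-integrable setT (fun w => (xi w * (W j t w - W j s w))%:E) /\
  (\int[P]_w (xi w * (W j t w - W j s w))%:E = 0)%E.
Proof.
(* For equal times the increment is 0; the facts on the normal law used afterwards require a
   positive standard deviation. *)
move=> s0; rewrite le_eqVlt => /predU1P[<- _ _|st mxi xiM].
  have -> : (fun w => (xi w * (W j s w - W j s w))%:E) = cst 0%E.
    by apply/funext => w; rewrite subrr mulr0.
  by rewrite integral0; split => //; exact: integrable0.
have ts0 : 0 < Num.sqrt (t - s) by rewrite sqrtr_gt0 subr_gt0.
apply: (@integral_bounded_indep0 _ _ _ P (augmented_filtration P W s)
  (fun w => W j t w - W j s w) (normal_prob 0 (Num.sqrt (t - s)))) => //.
- by move=> A; exact: augmented_filtration_measurable.
- exact: (@measurableT _ (g_sigma_algebraType _)).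
- by apply: measurable_brownian_increment => //; rewrite ltW// (le_lt_trans s0).
- by move=> A B FA mB; exact: brownian_increment_indep.
- exact: integrable_normal_prob_id.
- exact: integral_normal_prob_id.
Qed.

Lemma expectation_simple_integral0 (T : R) (j : 'I_d) (phi : simple_process)
    (t : R) : is_simple (augmented_filtration P W) T phi -> 0 <= t ->
  P.-integrable setT (EFin \o simple_integral (W j) phi t) /\
  (\int[P]_w (simple_integral (W j) phi t w)%:E = 0)%E.
Proof.
move=> [homo time0 _ coefP] t0.
pose f (i : 'I_(sp_size phi)) w : \bar R := (sp_coef phi i w *
  (W j (Num.min t (sp_time phi i.+1)) w - W j (Num.min t (sp_time phi i)) w))%:E.
have term i : P.-integrable setT (f i) /\ (\int[P]_w f i w = 0)%E.
  rewrite /f.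
  have le_time : sp_time phi i <= sp_time phi i.+1 by exact: homo.
  have [mcoef [M coefM]] := coefP i (ltn_ord i).
  (* If [t] comes first, both endpoints are cut to [t] and the term is 0. Otherwise the left
     endpoint remains [sp_time phi i], the time at which the coefficient is measurable. *)
  have [ti|it] := leP t (sp_time phi i).
    rewrite min_l ?(le_trans ti)//=.
    under eq_fun do rewrite subrr mulr0.
    by rewrite integral0; split => //; exact: integrable0.
  apply: expectation_brownian_increment0 coefM => //.
    by rewrite (le_trans time0)// homo.
  by rewrite le_min le_time ltW.
have simpleE : EFin \o simple_integral (W j) phi t =
    (fun w => \sum_(i < sp_size phi) f i w)%E.
  by apply/funext => w; rewrite sumEFin.
rewrite -[X in _ /\ X]/(\int[P]_w (EFin \o simple_integral (W j) phi t) w = 0)%E.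
rewrite simpleE; split.
  by apply: integrable_sum => // i _; have [] := term i.
rewrite integral_sum//; last by move=> i; have [] := term i.
by rewrite big1// => i _; have [] := term i.
Qed.

(** Under a probability, the L2 limit of simple integrals is also an L1 limit, by
    [|x| <= e + x ^+ 2 / e]; integrability and mean zero then pass to the limit. *)
Lemma expectation_ito_integral0 (T : R) (j : 'I_d) (f I : R -> Omega -> R)
    (t : R) : is_ito_integral P (augmented_filtration P W) T (W j) f I ->
  t \in `[0, T] ->
  P.-integrable setT (EFin \o I t) /\ (\int[P]_w (I t w)%:E = 0)%E.
Proof.
move=> [_ adI [phi [simple_phi _ cvg_phi]]] tT.
have t0 : 0 <= t by move: tT; rewrite in_itv/= => /andP[].
have mI : measurable_fun [set: Omega] (I t).
  move=> _ B mB; rewrite setTI.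
  exact: augmented_filtration_measurable (adI _ tT _ mB).
pose S n := simple_integral (W j) (phi n) t.
have iS n : P.-integrable setT (EFin \o S n).
  by have [] := expectation_simple_integral0 j (simple_phi n) t0.
have S0 n : (\int[P]_w (S n w)%:E = 0)%E.
  by have [] := expectation_simple_integral0 j (simple_phi n) t0.
have mSI n : measurable_fun [set: Omega] (fun w => S n w - I t w).
  apply: measurable_funB => //.
  by apply/measurable_EFinP; exact: (measurable_int P).
have dist_le (e : R) : 0 < e ->
    exists n, (\int[P]_w `|(S n w - I t w)%:E| <= (2 * e)%:E)%E.
  move=> e0.
  have /fine_cvgP[fin_phi] := cvg_phi _ tT.
  (* The quadratic term gets divided by [e] below, so a squared distance under [e * e] contributes
     at most [e]. *)
  move=> /cvgrPdist_lt/(_ _ (mulr_gt0 e0 e0)) close_phi.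
  have [n _ /(_ _ (leqnn n)) [fin_n close_n]] :
    \forall n \near \oo, (\int[P]_w ((S n w - I t w) ^+ 2)%:E)%E \is a fin_num /\
      `|0 - fine (\int[P]_w ((S n w - I t w) ^+ 2)%:E)%E| < e * e.
    by near=> n; split; near: n.
  exists n.
  apply: (@le_trans _ _
      (\int[P]_w (e%:E + e^-1%:E * ((S n w - I t w) ^+ 2)%:E))%E).
    apply: ge0_le_integral => //=.
    - exact/measurable_EFinP/measurableT_comp.
    - apply: emeasurable_funD => //; apply: measurable_funeM.
      exact/measurable_EFinP/measurable_funX.
    - move=> w _; rewrite -EFinM -EFinD lee_fin.
      set x := S n w - I t w; rewrite -(@ler_pM2l _ e)// mulrDr mulrA.
      rewrite divff ?gt_eqF// mul1r -(real_normK (num_real x)).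
      have := sqr_ge0 (e - `|x|); have := sqr_ge0 `|x|; nra.
  rewrite ge0_integralD//=; last 3 first.
  - by move=> w _; rewrite lee_fin ltW.
  - by move=> w _; rewrite mule_ge0// lee_fin ?sqr_ge0// invr_ge0 ltW.
  - apply: measurable_funeM; exact/measurable_EFinP/measurable_funX.
  rewrite integral_cst//= probability_setT mule1 ge0_integralZl//; last 3 first.
  - exact/measurable_EFinP/measurable_funX.
  - by move=> w _; rewrite lee_fin sqr_ge0.
  - by rewrite lee_fin invr_ge0 ltW.
  rewrite -(fineK fin_n) -EFinM -EFinD lee_fin [2 * e]mulr_natl mulr2n lerD2l.
  rewrite ler_pdivrMl// ltW// (le_lt_trans _ close_n)// sub0r normrN.
  exact: ler_norm.
have iSI n (C : R) : (\int[P]_w `|(S n w - I t w)%:E| <= C%:E)%E ->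
    P.-integrable setT (fun w => (S n w - I t w)%:E).
  move=> SIC; apply/integrableP; split; first exact/measurable_EFinP.
  by rewrite (le_lt_trans SIC)// ltry.
have iI : P.-integrable setT (EFin \o I t).
  have [n /iSI iSIn] := dist_le 1 ltr01.
  apply: (eq_integrable _ (fun w => (S n w)%:E - (S n w - I t w)%:E)%E) => //.
    by move=> w _; rewrite -EFinB/= subKr.
  exact: integrableB (iS n) iSIn.
split => //.
have /fineK IE := integrable_fin_num measurableT iI.
rewrite -IE; congr EFin; apply/eqP; rewrite -normr_le0.
apply/ler_addgt0Pr => e e0.
rewrite add0r -lee_fin -abse_EFin IE.
have [n dist_n] := dist_le (e / 2) (divr_gt0 e0 (ltr0n _ 2)).
move: dist_n; rewrite mulrC divfK// => dist_n.
have {1}-> : (\int[P]_w (EFin \o I t) w =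
    - \int[P]_w (S n w - I t w)%:E)%E.
  under [in RHS]eq_integral do rewrite EFinB.
  rewrite (integralB measurableT (iS n) iI).
  by rewrite (S0 n : (\int[P]_w (EFin \o S n) w = 0)%E) sub0e oppeK.
rewrite abseN (le_trans _ dist_n)//.
by apply: le_abse_integral => //; exact/measurable_EFinP.
Unshelve. all: by end_near. Qed.

End brownian_filtration.

(** * Fubini and means of processes *)

Section fubini_slab.
Local Open Scope ereal_scope.
Context {R : realType} {d1 d2 : measure_display} {T1 : measurableType d1}
  {T2 : measurableType d2}.
Variables (m1 : {sigma_finite_measure set T1 -> \bar R})
  (m2 : {sigma_finite_measure set T2 -> \bar R}).

(** An integrable function is finite almost everywhere, so the default value that [fine] gives to
    infinite values is read only on a null set. *)
Lemma integral_fine d (T : measurableType d) (m : {measure set T -> \bar R})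
    (D : set T) (f : T -> \bar R) : measurable D -> m.-integrable D f ->
  m.-integrable D (fun x => (fine (f x))%:E) /\
  \int[m]_(x in D) (fine (f x))%:E = \int[m]_(x in D) f x.
Proof.
move=> mD intf; have mf := measurable_int m intf.
have mff : measurable_fun D (fun x => (fine (f x))%:E).
  by apply/measurable_EFinP; exact: measurableT_comp.
split.
  apply: le_integrable intf => // x Dx.
  by case: (f x) => [r||] //=; rewrite normr0 leey.
apply: ae_eq_integral => //; have := integrable_ae mD intf.
by apply: filterS => x /= /[apply] fx; rewrite fineK.
Qed.

(** Fubini for the extension of [f] by zero outside the slab; in the main use [D] is a time interval
    and [T2] the sample space. The marginals carry [fine] because real-valued means and pathwise
    integrals have that form. *)
Lemma fubini_slab (D : set T1) (f : T1 -> T2 -> R) : measurable D ->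
  (m1 \x m2).-integrable (D `*` setT) (fun z => (f z.1 z.2)%:E) ->
  [/\ {ae m1, forall x, D x -> m2.-integrable setT (EFin \o f x)},
      m1.-integrable D (fun x => (fine (\int[m2]_y (f x y)%:E))%:E),
      m2.-integrable setT (fun y => (fine (\int[m1]_(x in D) (f x y)%:E))%:E) &
      \int[m1]_(x in D) (fine (\int[m2]_y (f x y)%:E))%:E =
      \int[m2]_y (fine (\int[m1]_(x in D) (f x y)%:E))%:E].
Proof.
move=> mD; set g := fun z => _.
have mDT : measurable (D `*` [set: T2]) by exact: measurableX.
move=> /(integrable_mkcond _ mDT) intg.
have gE x y : D x -> (g \_ (D `*` setT)) (x, y) = (f x y)%:E.
  by move=> Dx; rewrite patchE ifT// inE.
have g0 x y : ~ D x -> (g \_ (D `*` setT)) (x, y) = 0.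
  by move=> nDx; rewrite patchE ifF//; apply/negP; rewrite inE => -[].
have FE : fubini_F m2 (g \_ (D `*` setT)) = (fun x => \int[m2]_y (f x y)%:E) \_ D.
  apply/funext => x; rewrite /fubini_F patchE; case: ifPn => [|/negP].
    by rewrite inE => Dx; apply: eq_integral => y _; rewrite gE.
  by rewrite inE => nDx; apply: integral0_eq => y _; rewrite g0.
have GE : fubini_G m1 (g \_ (D `*` setT)) =
    (fun y => \int[m1]_(x in D) (f x y)%:E).
  apply/funext => y; rewrite /fubini_G [RHS]integral_mkcond.
  apply: eq_integral => x _; rewrite [RHS]patchE; case: ifPn => [|/negP].
    by rewrite inE => /gE.
  by rewrite inE => /g0.
have intF : m1.-integrable D (fun x => \int[m2]_y (f x y)%:E).
  by apply/(integrable_mkcond _ mD); rewrite -FE; exact: integrable_fubini_F.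
(* The marginal is dominated by the marginal of the absolute value, whose integral is finite by
   Tonelli. *)
have intG : m2.-integrable setT (fun y => \int[m1]_(x in D) (f x y)%:E).
  rewrite -GE; have mg := measurable_int _ intg.
  have mabsg : measurable_fun setT (abse \o (g \_ (D `*` setT))).
    exact: measurableT_comp.
  apply/integrableP; split; first exact: (measurable_fubini_G intg).
  apply: le_lt_trans ((integrable21ltyP _ _ mg).1 intg).
  apply: ge0_le_integral => //.
  - by apply: measurableT_comp => //; exact: (measurable_fubini_G intg).
  - apply: (measurable_fun_fubini_tonelli_G (abse \o (g \_ (D `*` setT)))) => //.
    by move=> z; exact: abse_ge0.
  - move=> y _; apply: le_abse_integral => //.
    exact: measurableT_comp mg (measurable_pair2 y).
have [iF ->] := integral_fine mD intF.
have [iG ->] := integral_fine measurableT intG.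
split=> //.
  have := ae_integrable1 intg; apply: filterS => x ix Dx.
  by apply: eq_integrable ix => // y _; rewrite gE.
rewrite [LHS]integral_mkcond -FE -GE.
by rewrite integral12_prod_meas1// -integral21_prod_meas1.
Qed.

(** Relates the iterated integral in [L2_adapted] to the product measure, where the domination
    arguments take place. *)
Lemma ge0_integral_slab (D : set T1) (f : T1 -> T2 -> R) : measurable D ->
  measurable_fun (D `*` setT) (fun z => f z.1 z.2) ->
  (forall x y, 0 <= f x y)%R ->
  \int[m1 \x m2]_(z in D `*` setT) (f z.1 z.2)%:E =
  \int[m2]_y \int[m1]_(x in D) (f x y)%:E.
Proof.
move=> mD mf f0; have mDT : measurable (D `*` [set: T2]) by exact: measurableX.
rewrite integral_mkcond fubini_tonelli2//; last 2 first.
- exact/(measurable_restrictT _ mDT)/measurable_EFinP.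
- by move=> z; rewrite patchE; case: ifP => // _; rewrite lee_fin.
apply: eq_integral => y _; rewrite /fubini_G [RHS]integral_mkcond.
apply: eq_integral => x _; rewrite !patchE.
by congr (if _ then _ else _); apply/idP/idP; rewrite !inE => //= -[].
Qed.

Lemma integrable_tensor (D : set T1) (a : T1 -> R) (b : T2 -> R) :
  measurable D -> m1.-integrable D (EFin \o a) ->
  m2.-integrable setT (EFin \o b) ->
  (m1 \x m2).-integrable (D `*` setT) (fun z => (a z.1 * b z.2)%:E).
Proof.
move=> mD inta intb.
have mDT : measurable (D `*` [set: T2]) by exact: measurableX.
have inta0 : m1.-integrable setT (EFin \o (a \_ D)).
  by rewrite -restrict_EFin; exact: (integrable_mkcond _ mD).1.
have ma : measurable_fun setT (a \_ D).
  by apply/measurable_EFinP; exact: measurable_int inta0.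
have mb : measurable_fun setT b.
  by apply/measurable_EFinP; exact: measurable_int intb.
apply/(integrable_mkcond _ mDT).
rewrite (_ : _ \_ _ = fun z => ((a \_ D) z.1 * b z.2)%:E); last first.
  apply/funext => -[x y]; rewrite [LHS]patchE /= patchE.
  have -> : ((x, y) \in D `*` [set: T2]) = (x \in D).
    by apply/idP/idP; rewrite !inE => // -[].
  by case: ifP => // _; rewrite mul0r.
have mab : measurable_fun [set: T1 * T2]
    (fun z => ((a \_ D) z.1 * b z.2)%:E).
  apply/measurable_EFinP; apply: measurable_funM.
    exact: measurableT_comp ma measurable_fst.
  exact: measurableT_comp mb measurable_snd.
apply/(integrable12ltyP _ _ mab) => /=.
have [_ intb_fin] := integrableP _ _ _ intb.
have [_ inta_fin] := integrableP _ _ _ inta0.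
have absE x : \int[m2]_y `|((a \_ D) x * b y)%:E| =
    `|((a \_ D) x)%:E| * \int[m2]_y `|(b y)%:E|.
  rewrite -ge0_integralZl//; last exact/measurable_EFinP/measurableT_comp.
  by apply: eq_integral => y _; rewrite EFinM abseM.
under eq_integral do rewrite absE.
rewrite ge0_integralZr//; last 2 first.
- exact/measurable_EFinP/measurableT_comp.
- exact: integral_ge0.
by rewrite lte_mul_pinfty ?ge0_fin_numE ?integral_ge0.
Qed.

End fubini_slab.

Section process_mean.
Context {R : realType} {d0 : measure_display} {Omega : measurableType d0}.
Variable P : probability Omega R.
Notation mu := (@lebesgue_measure R).

Definition mean (X : Omega -> R) : R := fine 'E_P[X].

Lemma mean_integral : mean = fun X => fine (\int[P]_w (X w)%:E)%E.
Proof. by apply/funext => X; rewrite /mean unlock. Qed.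

Lemma meanE (X : Omega -> R) : P.-integrable setT (EFin \o X) ->
  ('E_P[X] = (mean X)%:E)%E.
Proof. by move=> iX; rewrite fineK// unlock integrable_fin_num. Qed.

Definition process_integrable (D : set (measurableTypeR R))
    (f : R -> Omega -> R) :=
  (mu \x P)%E.-integrable (D `*` setT) (fun z => (f z.1 z.2)%:E).

Lemma process_integrableS (D D' : set (measurableTypeR R)) (f : R -> Omega -> R) :
  measurable D -> measurable D' -> D' `<=` D -> process_integrable D f ->
  process_integrable D' f.
Proof.
move=> mD mD' DD'; apply: integrableS; [exact: measurableX..|].
by move=> z [Dz _]; split=> //; exact: DD'.
Qed.

Lemma process_integrableD (D : set (measurableTypeR R)) (f g : R -> Omega -> R) :
  measurable D -> process_integrable D f -> process_integrable D g ->
  process_integrable D (fun t w => f t w + g t w).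
Proof.
move=> mD intf intg; have mDT : measurable (D `*` [set: Omega]).
  exact: measurableX.
by have := integrableD mDT intf intg.
Qed.

Lemma process_integrableZl (D : set (measurableTypeR R)) (f : R -> Omega -> R)
    (c : R) :
  measurable D -> process_integrable D f ->
  process_integrable D (fun t w => c * f t w).
Proof.
move=> mD intf; have mDT : measurable (D `*` [set: Omega]).
  exact: measurableX.
by have := integrableZl mDT c intf.
Qed.

Lemma process_integrable_sum (D : set (measurableTypeR R)) (I : Type) (s : seq I)
    (f : I -> R -> Omega -> R) :
  measurable D -> (forall i, process_integrable D (f i)) ->
  process_integrable D (fun t w => \sum_(i <- s) f i t w).
Proof.
move=> mD intf; elim: s => [|i s IH].
  rewrite /process_integrable (_ : (fun z => _) = cst 0%E).
    exact: integrable0.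
  by apply/funext => z; rewrite big_nil.
rewrite (_ : (fun t w => _) =
    (fun t w => f i t w + \sum_(j <- s) f j t w)); last first.
  by apply/funext => t; apply/funext => w; rewrite big_cons.
exact: process_integrableD.
Qed.

Lemma process_integrable_deterministic (D : set (measurableTypeR R))
    (c : R -> R) :
  measurable D -> mu.-integrable D (EFin \o c) ->
  process_integrable D (fun t _ => c t).
Proof.
move=> mD intc; have mDT : measurable (D `*` [set: Omega]).
  exact: measurableX.
have int1 : P.-integrable setT (EFin \o cst 1).
  exact: finite_measure_integrable_cst.
have := integrable_tensor mD intc int1; apply: eq_integrable => // z _.
by rewrite mulr1.
Qed.

Lemma mean_process_integrable (D : set (measurableTypeR R))
    (f : R -> Omega -> R) :
  measurable D -> process_integrable D f ->
  [/\ {ae mu, forall t, D t -> P.-integrable setT (EFin \o f t)},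
      mu.-integrable D (fun t => (mean (f t))%:E),
      P.-integrable setT (fun w => (Rintegral mu D (f ^~ w))%:E) &
      mean (fun w => Rintegral mu D (f ^~ w)) =
        Rintegral mu D (fun t => mean (f t))].
Proof.
move=> mD /(fubini_slab mD)[ae_int int1 int2 eq12].
by rewrite mean_integral; split=> //; rewrite {2}/Rintegral eq12.
Qed.

End process_mean.

Section mean_of_ito_process.
Context {R : realType} {d0 : measure_display} {Omega : measurableType d0}.
Variables (P : probability Omega R) (d : nat) (W : 'I_d -> R -> Omega -> R).
Hypothesis P_complete : measure_is_complete P.
Hypothesis W_brownian : standard_brownian P W.
Variable T : R.
Notation mu := (@lebesgue_measure R).
Let F := augmented_filtration P W.
Let mI (a b : R) : measurable (`[a, b]%classic : set (measurableTypeR R)).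
Proof. exact: measurable_itv. Qed.

(** The slab has finite measure and [|x| <= 1 + x ^+ 2]. This makes Fubini applicable to controls
    and states. *)
Lemma L2_adapted_process_integrable (f : R -> Omega -> R) :
  L2_adapted P F T f -> process_integrable P `[0, T] f.
Proof.
move=> [mf _ L2f].
have mDT : measurable (`[0, T]%classic `*` [set: Omega] :
    set (measurableTypeR R * Omega)) by exact: measurableX.
have {}mf : measurable_fun (`[0, T]%classic `*` [set: Omega] :
  set (measurableTypeR R * Omega)) (fun z => f z.1 z.2) by exact: mf.
have mf2 : measurable_fun (`[0, T]%classic `*` [set: Omega] :
    set (measurableTypeR R * Omega)) (fun z => ((f z.1 z.2) ^+ 2)%:E).
  by apply/measurable_EFinP; exact: measurable_funX.
apply/integrableP; split; first exact/measurable_EFinP.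
apply: (@le_lt_trans _ _ (\int[(mu \x P)%E]_(z in `[0%R, T]%classic `*` setT)
    (1 + ((f z.1 z.2) ^+ 2)%:E))%E).
  apply: ge0_le_integral => //=.
  - exact/measurable_EFinP/measurableT_comp.
  - exact: emeasurable_funD.
  - move=> z _; rewrite -EFinD lee_fin.
    set x := f _ _; rewrite -(real_normK (num_real x)).
    by have := sqr_ge0 (`|x| - 1); have := sqr_ge0 `|x|; nra.
rewrite ge0_integralD//=; last first.
  by move=> z _; rewrite lee_fin sqr_ge0.
rewrite integral_cst// mul1e lte_add_pinfty//.
  rewrite -[X in (X < _)%E]/((mu \x P)%E (`[0%R, T]%classic `*` setT)).
  rewrite product_measure1E//= probability_setT mule1.
  by rewrite lebesgue_measure_itv/=; case: ifP => _; rewrite ?ltry.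
apply: le_lt_trans L2f; rewrite (@ge0_integral_slab _ _ _ _ _ mu P `[0, T]%classic
  (fun t w => (f t w) ^+ 2))//; last first.
- by move=> t w; exact: sqr_ge0.
- exact: measurable_funX.
Qed.

Lemma adapted_measurable (f : R -> Omega -> R) (t : R) : adapted F T f ->
  t \in `[0, T] -> measurable_fun [set: Omega] (f t).
Proof.
move=> adf tT _ B mB; rewrite setTI.
exact: (augmented_filtration_measurable P_complete W_brownian (adf _ tT _ mB)).
Qed.

(** The Ito integrals have mean zero and Fubini moves the mean inside the drift integral. The
    equation holds only almost surely for each [t], so the measurability of [Z t] is taken from
    adaptedness. *)
Lemma mean_ito_process (z0 : R) (a : R -> Omega -> R)
    (s : 'I_d -> R -> Omega -> R) (Z : R -> Omega -> R) (t : R) :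
  is_ito_process P F T W z0 a s Z -> process_integrable P `[0, T] a ->
  t \in `[0, T] ->
  P.-integrable setT (EFin \o Z t) /\
  mean P (Z t) = z0 + Rintegral mu `[0, t] (fun r => mean P (a r)).
Proof.
move=> [[_ adZ _] _ _ [I [itoI ZE]]] inta tT.
have [t0 tleT] : 0 <= t /\ t <= T by move: tT; rewrite in_itv/= => /andP[].
have inta_t : process_integrable P `[0, t] a.
  apply: process_integrableS inta => // r /=.
  by rewrite !in_itv/= => /andP[-> /le_trans->].
have [_ _ intA meanA] := mean_process_integrable (mI 0 t) inta_t.
pose A w := Rintegral mu `[0, t] (a ^~ w).
rewrite -/A in intA meanA.
have itoP j := expectation_ito_integral0 P_complete W_brownian (itoI j) tT.
pose V w := z0 + A w + \sum_(j < d) I j t w.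
have VE : EFin \o V =
    (fun w => (z0%:E + (A w)%:E) + \sum_(j < d) (I j t w)%:E)%E.
  by apply/funext => w; rewrite /= !EFinD sumEFin.
have intz0 : P.-integrable setT (fun=> z0%:E).
  exact: finite_measure_integrable_cst.
have intsum : P.-integrable setT (fun w => \sum_(j < d) (I j t w)%:E)%E.
  by apply: integrable_sum => // j _; have [] := itoP j.
have intzA : P.-integrable setT (fun w => z0%:E + (A w)%:E)%E.
  exact: integrableD.
have intV : P.-integrable setT (EFin \o V) by rewrite VE; exact: integrableD.
have mZ : measurable_fun [set: Omega] (EFin \o Z t).
  by apply/measurable_EFinP; exact: adapted_measurable adZ tT.
have ZV : ae_eq P setT (EFin \o Z t) (EFin \o V).
  by have := ZE _ tT; apply: filterS => w Zw _ /=; rewrite Zw.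
split.
  apply/integrableP; split => //.
  have [mV finV] := integrableP _ _ _ intV.
  rewrite (ae_eq_integral (abse \o (EFin \o V)))//.
  - exact: measurableT_comp.
  - exact: measurableT_comp.
  - exact: ae_eq_abse.
rewrite -meanA mean_integral.
rewrite -[X in fine X]/(\int[P]_w (EFin \o Z t) w)%E.
rewrite (ae_eq_integral (EFin \o V))//; last exact: (measurable_int P).
rewrite VE integralD// integralD// integral_sum//; last first.
  by move=> j; have [] := itoP j.
rewrite big1 ?adde0; last by move=> j _; have [] := itoP j.
rewrite integral_cst//= probability_setT mule1 fineD//.
exact: integrable_fin_num.
Qed.

End mean_of_ito_process.

(** * The matrix exponential *)

Section matrix_exponential.
Context {R : realType} {m : nat}.
Implicit Types (A : 'M[R]_m) (x : R).

Lemma cvg_finite_sum {T : Type} (F : set_system T) {FF : Filter F} (I : Type)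
    (r : seq I) (f : I -> T -> R) (l : I -> R) :
  (forall i, f i x @[x --> F] --> l i) ->
  \sum_(i <- r) f i x @[x --> F] --> \sum_(i <- r) l i.
Proof.
move=> fl; elim: r => [|i r IH].
  by rewrite big_nil; under eq_cvg do rewrite big_nil; exact: cvg_cst.
by rewrite big_cons; under eq_cvg do rewrite big_cons; exact: cvgD.
Qed.

Lemma cvg_mulmxl {T : Type} (F : set_system T) {FF : Filter F} p q r
    (B : 'M[R]_(p, q)) (M_ : T -> 'M[R]_(q, r)) (M : 'M[R]_(q, r)) :
  (forall i j, M_ x i j @[x --> F] --> M i j) ->
  forall i j, (B *m M_ x) i j @[x --> F] --> (B *m M) i j.
Proof.
move=> M_M i j; rewrite mxE; under eq_cvg do rewrite mxE.
by apply: cvg_finite_sum => l; apply: cvgMr; exact: M_M.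
Qed.

Lemma cvg_mulmxr {T : Type} (F : set_system T) {FF : Filter F} p q r
    (B : 'M[R]_(q, r)) (M_ : T -> 'M[R]_(p, q)) (M : 'M[R]_(p, q)) :
  (forall i j, M_ x i j @[x --> F] --> M i j) ->
  forall i j, (M_ x *m B) i j @[x --> F] --> (M *m B) i j.
Proof.
move=> M_M i j; rewrite mxE; under eq_cvg do rewrite mxE.
by apply: cvg_finite_sum => l; apply: cvgMl; exact: M_M.
Qed.

(** [N] is the sum of the absolute values of all entries, which dominates every row sum and hence
    one more factor [A]. *)
Lemma mxexp_entry_le A : exists2 N : R, 0 <= N &
  forall n i j, `|(A ^+ n) i j| <= N ^+ n.
Proof.
exists (\sum_i \sum_j `|A i j|).
  by apply: sumr_ge0 => i _; apply: sumr_ge0 => j _.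
elim=> [|n IH] i j.
  by rewrite !expr0 mxE; case: eqP; rewrite ?normr1 ?normr0.
rewrite exprS mxE (le_trans (ler_norm_sum _ _ _))//.
under eq_bigr do rewrite normrM.
apply: (@le_trans _ _ (\sum_j0 `|A i j0| * (\sum_i \sum_j `|A i j|) ^+ n)).
  by apply: ler_sum => l _; rewrite ler_wpM2l.
rewrite -mulr_suml [leRHS]exprS ler_wpM2r//.
  by rewrite exprn_ge0// sumr_ge0// => k _; rewrite sumr_ge0.
rewrite [leRHS](bigD1 i)//= lerDl sumr_ge0// => k _; exact: sumr_ge0.
Qed.

(** Power series in [x] of an entry of [B *m mexp (x *: A)]. The left factor makes the family closed
    under differentiation, which replaces [B] by [B *m A]. *)
Definition mexp_coef p (B : 'M[R]_(p, m)) A i j (n : nat) : R :=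
  (B *m A ^+ n) i j / n`!%:R.

Lemma is_cvg_pseries_dominated (c : R^nat) (K N x : R) : 0 <= K -> 0 <= N ->
  (forall n, `|c n| <= K * (N ^+ n / n`!%:R)) -> cvgn (pseries c x).
Proof.
move=> K0 N0 cK; apply: normed_cvg.
apply: (@series_le_cvg _ _ (K *: exp_coeff (N * `|x|))) => [n|n|n|] /=.
- exact: normr_ge0.
- by rewrite mulr_ge0// divr_ge0// exprn_ge0// mulr_ge0.
- rewrite normrM normrX; apply: le_trans (ler_wpM2r _ (cK n)) _.
    by rewrite exprn_ge0.
  rewrite -mulrA ler_wpM2l// mulrAC -exprMn; exact: lexx.
- by apply: is_cvg_seriesZ; exact: is_cvg_series_exp_coeff.
Qed.

Lemma mexp_coef_le p (B : 'M[R]_(p, m)) A i j n (N : R) :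
  (forall n i j, `|(A ^+ n) i j| <= N ^+ n) ->
  `|mexp_coef B A i j n| <= (\sum_l `|B i l|) * (N ^+ n / n`!%:R).
Proof.
move=> AN; rewrite /mexp_coef normrM [`|_^-1|]ger0_norm// mulrA ler_wpM2r//.
rewrite mxE (le_trans (ler_norm_sum _ _ _))// mulr_suml ler_sum// => l _.
by rewrite normrM ler_wpM2l.
Qed.

Lemma is_cvg_mexp p (B : 'M[R]_(p, m)) A i j x :
  cvgn (pseries (mexp_coef B A i j) x).
Proof.
have [N N0 AN] := mxexp_entry_le A.
apply: (@is_cvg_pseries_dominated _ (\sum_l `|B i l|) N) => // [|n].
  exact: sumr_ge0.
exact: mexp_coef_le.
Qed.

Lemma mexp_coef_diffs p (B : 'M[R]_(p, m)) A i j :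
  pseries_diffs (mexp_coef B A i j) = mexp_coef (B *m A) A i j.
Proof.
apply/funext => n; rewrite /pseries_diffs /mexp_coef exprS mulmxA factS natrM.
by rewrite invfM mulrCA [_%:R * _]mulrA divff ?mul1r// pnatr_eq0.
Qed.

Lemma expmxZ x A n : (x *: A) ^+ n = x ^+ n *: A ^+ n.
Proof.
elim: n => [|n IH]; first by rewrite !expr0 scale1r.
rewrite 3!exprS IH -[LHS]/((x *: A) *m (x ^+ n *: A ^+ n)).
by rewrite -scalemxAl -scalemxAr scalerA.
Qed.

(** [mexp] is a limit entry by entry; matrix identities are proved on these partial sums and passed
    to the limit. *)
Definition mexp_partial A x (N : nat) : 'M[R]_m :=
  \sum_(0 <= n < N) (n`!%:R^-1 * x ^+ n) *: A ^+ n.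

Lemma cvg_mexp_partial A x i j :
  mexp_partial A x N i j @[N --> \oo] --> mexp (x *: A) i j.
Proof.
rewrite mxE; set s := (X in series X).
have -> : mexp_partial A x ^~ i ^~ j = series s.
  apply/funext => N; rewrite /mexp_partial /series/= summxE.
  apply: eq_bigr => n _; rewrite /s !mxE.
  by rewrite expmxZ mxE -mulrA [LHS]mulrC.
have -> : series s = pseries (mexp_coef 1%:M A i j) x.
  rewrite /pseries /s; congr series; apply/funext => n.
  rewrite /= /mexp_coef mul1mx mulrAC.
  by rewrite expmxZ mxE [x ^+ n * _]mulrC.
exact: is_cvg_mexp.
Qed.

Lemma limn_mexp p (B : 'M[R]_(p, m)) A i j x :
  limn (pseries (mexp_coef B A i j) x) = (B *m mexp (x *: A)) i j.
Proof.
apply/cvg_lim => //; have -> : pseries (mexp_coef B A i j) x =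
    (fun N => (B *m mexp_partial A x N) i j).
  apply/funext => N; rewrite /pseries /series/= mulmx_sumr summxE.
  apply: eq_bigr => n _.
  by rewrite -scalemxAr [in RHS]mxE /mexp_coef -mulrA [LHS]mulrC.
by apply: cvg_mulmxl => k l; exact: cvg_mexp_partial.
Qed.

Lemma mexp0 A : mexp (0 *: A) = 1%:M.
Proof.
apply/matrixP => i j; apply: (cvg_unique _ (@cvg_mexp_partial A 0 i j)) => //.
apply: cvg_near_cst; near=> N; rewrite /mexp_partial.
have -> : N = N.-1.+1 by rewrite prednK//; near: N; exact: nbhs_infty_gt.
rewrite big_nat_recl//= big1 ?addr0 => [|n _].
  by rewrite fact0 invr1 mul1r expr0 scale1r.
by rewrite exprS mul0r mulr0 scale0r.
Unshelve. all: by end_near. Qed.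

Lemma mexpC A x : A *m mexp (x *: A) = mexp (x *: A) *m A.
Proof.
apply/matrixP => i j.
have lim_l : (A *m mexp_partial A x N) i j @[N --> \oo] -->
    (A *m mexp (x *: A)) i j.
  exact: (cvg_mulmxl (@cvg_mexp_partial A x)).
move: lim_l.
have -> : (fun N => (A *m mexp_partial A x N) i j) =
    (fun N => (mexp_partial A x N *m A) i j).
  apply/funext => N; rewrite /mexp_partial mulmx_sumr mulmx_suml.
  congr (_ _ i j); apply: eq_bigr => n _.
  rewrite -scalemxAr -scalemxAl; congr (_ *: _).
  by rewrite -[LHS](exprS A n) -[RHS](exprSr A n).
move=> lim_l; apply: (cvg_unique _ lim_l) => //.
exact: (cvg_mulmxr (@cvg_mexp_partial A x)).
Qed.

Lemma is_derive_mexp p (B : 'M[R]_(p, m)) A i j x :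
  is_derive x 1 (fun x => (B *m mexp (x *: A)) i j)
    ((B *m A *m mexp (x *: A)) i j).
Proof.
have -> : (fun x => (B *m mexp (x *: A)) i j) =
    (fun x => limn (pseries (mexp_coef B A i j) x)).
  by apply/funext => y; rewrite limn_mexp.
rewrite -limn_mexp -mexp_coef_diffs.
(* Termwise differentiation at [x] requires convergence at some point of larger absolute value; the
   series converge everywhere. *)
apply: (@pseries_snd_diffs _ _ (`|x| + 1)).
- exact: is_cvg_mexp.
- by rewrite mexp_coef_diffs; exact: is_cvg_mexp.
- by rewrite !mexp_coef_diffs; exact: is_cvg_mexp.
- by rewrite [ltRHS]ger0_norm ?addr_ge0// ltrDl.
Qed.

Lemma continuous_mexp p (B : 'M[R]_(p, m)) A i j :
  continuous (fun x => (B *m mexp (x *: A)) i j).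
Proof.
move=> x; apply: differentiable_continuous; apply/derivable1_diffP.
by have [] := is_derive_mexp B A i j x.
Qed.

(** Termwise primitive, vanishing at 0, of the series [mexp_coef]. It integrates
    [B *m mexp (x *: A)] without inverting [A]. *)
Definition mexp_primitive_coef p (B : 'M[R]_(p, m)) A i j (n : nat) : R :=
  if n is n'.+1 then mexp_coef B A i j n' / n%:R else 0.

Lemma mexp_primitive_coef_diffs p (B : 'M[R]_(p, m)) A i j :
  pseries_diffs (mexp_primitive_coef B A i j) = mexp_coef B A i j.
Proof.
apply/funext => n; rewrite /pseries_diffs/= mulrCA divff ?mulr1// pnatr_eq0.
Qed.

Definition mexp_primitive p (B : 'M[R]_(p, m)) A x : 'M[R]_(p, m) :=
  \matrix_(i, j) limn (pseries (mexp_primitive_coef B A i j) x).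

Lemma is_cvg_mexp_primitive p (B : 'M[R]_(p, m)) A i j x :
  cvgn (pseries (mexp_primitive_coef B A i j) x).
Proof.
have [N N0 AN] := mxexp_entry_le A.
(* The primitive shifts the index by one, and [N ^+ n <= N ^+ n.+1] may fail for [N < 1]; hence
   [N + 1]. *)
apply: (@is_cvg_pseries_dominated _ (\sum_l `|B i l|) (N + 1)) => [||n].
- exact: sumr_ge0.
- exact: addr_ge0.
case: n => [|n] /=.
  by rewrite normr0 mulr_ge0 ?sumr_ge0// divr_ge0// exprn_ge0// addr_ge0.
rewrite normrM normfV [`|n.+1%:R|]ger0_norm// factS natrM invfM.
set S := \sum_(l < m) _.
have -> : S * ((N + 1) ^+ n.+1 * (n.+1%:R^-1 / n`!%:R)) =
  S * ((N + 1) ^+ n.+1 / n`!%:R) / n.+1%:R by rewrite mulrCA !mulrA; ring.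
rewrite ler_wpM2r// (le_trans (mexp_coef_le _ _ _ _ AN))//.
rewrite ler_wpM2l ?sumr_ge0// ler_wpM2r//.
rewrite (@le_trans _ _ ((N + 1) ^+ n))//.
  by rewrite lerXn2r ?nnegrE ?addr_ge0// lerDl.
by rewrite exprS ler_peMl ?exprn_ge0 ?addr_ge0// lerDr.
Qed.

Lemma is_derive_mexp_primitive p (B : 'M[R]_(p, m)) A i j x :
  is_derive x 1 (fun x => mexp_primitive B A x i j)
    ((B *m mexp (x *: A)) i j).
Proof.
rewrite -limn_mexp -mexp_primitive_coef_diffs; under eq_fun do rewrite mxE.
apply: (@pseries_snd_diffs _ _ (`|x| + 1)).
- exact: is_cvg_mexp_primitive.
- by rewrite mexp_primitive_coef_diffs; exact: is_cvg_mexp.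
- rewrite mexp_primitive_coef_diffs mexp_coef_diffs; exact: is_cvg_mexp.
- by rewrite [ltRHS]ger0_norm ?addr_ge0// ltrDl.
Qed.

Lemma mexp_primitive0 p (B : 'M[R]_(p, m)) A : mexp_primitive B A 0 = 0.
Proof.
apply/matrixP => i j; rewrite !mxE; apply/cvg_lim => //.
rewrite (_ : pseries _ _ = cst 0); first exact: cvg_cst.
apply/funext => N; rewrite /pseries /series/= big1// => -[|n] _ /=.
  by rewrite mul0r.
by rewrite exprS mul0r mulr0.
Qed.

(* Both sides have the derivative [B *m mexp (x *: A) *m A] and agree at 0. *)
Lemma mexp_primitive_mulmx p (B : 'M[R]_(p, m)) A x :
  mexp_primitive B A x *m A + B = B *m mexp (x *: A).
Proof.
apply/matrixP => i j; apply/eqP; rewrite -subr_eq0; apply/eqP.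
pose f y := (mexp_primitive B A y *m A + B) i j - (B *m mexp (y *: A)) i j.
have f0 : f 0 = 0.
  by rewrite /f mexp_primitive0 mul0mx add0r mexp0 mulmx1 subrr.
rewrite -[LHS]/(f x) -f0; apply: is_derive_0_is_cst => y; rewrite /f.
have dsum : is_derive y 1 (fun y => (mexp_primitive B A y *m A + B) i j)
    ((B *m mexp (y *: A) *m A) i j).
  have -> : (fun y => (mexp_primitive B A y *m A + B) i j) =
      (\sum_l (A l j \*: (fun y => mexp_primitive B A y i l)) + cst (B i j)).
    apply/funext => z; rewrite mxE [in LHS]mxE [in RHS]/= fct_sumE.
    by congr (_ + _); apply: eq_bigr => l _; rewrite mulrC.
  have -> : (B *m mexp (y *: A) *m A) i j =
      \sum_l A l j *: (B *m mexp (y *: A)) i l + 0.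
    by rewrite mxE addr0; apply: eq_bigr => l _; rewrite mulrC.
  apply: is_deriveD; apply: is_derive_sum => l; apply: is_deriveZ.
  exact: is_derive_mexp_primitive.
have -> : 0 = (B *m mexp (y *: A) *m A) i j - (B *m A *m mexp (y *: A)) i j.
  by rewrite -!mulmxA mexpC subrr.
by apply: is_deriveB; exact: is_derive_mexp.
Qed.

End matrix_exponential.

(** * The costate equation *)

Section costate_representation.
Context {R : realType} {m k d : nat}.
Variable pb : problem R m k d.
Notation mu := (@lebesgue_measure R).

Lemma is_derive_translate (f : R -> R) (c s df : R) :
  is_derive (s - c) 1 f df -> is_derive s 1 (fun s => f (s - c)) df.
Proof.
move=> dfs; rewrite -[df]mulr1; apply: (@is_derive1_comp _ f (shift (- c))) => //.
exact: is_derive_shift.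
Qed.

Lemma is_derive_reflect (f : R -> R) (c s df : R) :
  is_derive (c - s) 1 f df -> is_derive s 1 (fun s => f (c - s)) (- df).
Proof.
move=> dfs; rewrite -mulrN1.
apply: (@is_derive1_comp _ f (cst c - id)) => //.
by rewrite -[-1]sub0r; exact: is_deriveB.
Qed.

Lemma costate_formula_primitive (tf t : R) : t <= tf ->
  costate_formula pb tf t = - mexp_primitive (KX pb) (cA pb) (tf - t).
Proof.
rewrite le_eqVlt => /predU1P[->|ttf].
  apply/rowP => j; rewrite subrr mexp_primitive0 !mxE set_itv1 Rintegral_set1.
  by rewrite oppr0.
apply/rowP => j; rewrite [LHS]mxE [RHS]mxE; congr (- _); rewrite /Rintegral.
pose F (s : R) : R := mexp_primitive (KX pb) (cA pb) (s - t) 0 j.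
have dF (s : R) : is_derive s 1 F ((KX pb *m mexp ((s - t) *: cA pb)) 0 j).
  apply: (@is_derive_translate (fun x => mexp_primitive (KX pb) (cA pb) x 0 j)).
  exact: is_derive_mexp_primitive.
have cF : continuous F.
  move=> s; apply: differentiable_continuous; apply/derivable1_diffP.
  by have [] := dF s.
have cf : continuous (fun s => (KX pb *m mexp ((s - t) *: cA pb)) 0 j).
  move=> s; apply: (@continuous_comp _ _ _ (fun s => s - t)
    (fun s => (KX pb *m mexp (s *: cA pb)) 0 j)).
    by apply: cvgB; [exact: cvg_id|exact: cvg_cst].
  exact: continuous_mexp.
rewrite (@continuous_FTC2 _ _ F)//.
- by rewrite -EFinB /= /F subrr mexp_primitive0 [X in _ - X]mxE subr0.
- exact: continuous_subspaceT.
- split=> [s _||]; first by have [] := dF s.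
    exact/cvg_at_right_filter/cF.
  exact/cvg_at_left_filter/cF.
- by move=> s _; rewrite derive1E; have [_ ->] := dF s.
Qed.

(** The closed form has derivative [KX *m mexp ((tf - t) *: A)], which [mexp_primitive_mulmx] turns
    into the right-hand side of the costate equation. Since [p] is arbitrary outside [[0, tf]],
    regularity is proved for the globally defined [q]. *)
Lemma costate_of_formula (tf : R) (p : R -> 'cV[R]_m) : 0 <= tf ->
  (forall t, t \in `[0, tf] -> (p t)^T = costate_formula pb tf t) ->
  costate pb tf p.
Proof.
move=> tf0 pE.
pose q t : 'rV[R]_m := - mexp_primitive (KX pb) (cA pb) (tf - t).
have pq t : t \in `[0, tf] -> (p t)^T = q t.
  move=> t0tf; rewrite pE// costate_formula_primitive//.
  by move: t0tf; rewrite in_itv/= => /andP[].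
have pqi t i : t \in `[0, tf] -> p t i 0 = q t 0 i.
  by move=> /pq <-; rewrite mxE.
have dq (t : R) (i : 'I_m) : is_derive t 1 (fun s => q s 0 i)
    ((KX pb *m mexp ((tf - t) *: cA pb)) 0 i).
  have -> : (fun s => q s 0 i) =
      - (fun s => mexp_primitive (KX pb) (cA pb) (tf - s) 0 i).
    by apply/funext => s; rewrite /q mxE.
  rewrite -[X in is_derive _ _ _ X]opprK; apply: is_deriveN.
  apply: (@is_derive_reflect (fun x => mexp_primitive (KX pb) (cA pb) x 0 i)).
  exact: is_derive_mexp_primitive.
split.
- move=> i; apply: (@subspace_eq_continuous _ _ _ (fun t => q t 0 i)).
    by move=> t t0tf; rewrite /from_subspace pqi//; move: t0tf; rewrite inE.
  apply: continuous_subspaceT => t; apply: differentiable_continuous.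
  by apply/derivable1_diffP; have [] := dq t i.
- move=> t t0tf i.
  have -> : (- ((p t)^T *m cA pb) + KX pb) 0 i =
      (KX pb *m mexp ((tf - t) *: cA pb)) 0 i.
    rewrite -mexp_primitive_mulmx pq ?mulNmx ?opprK//.
    exact: subset_itv_oo_cc.
  apply: (near_eq_is_derive (f := fun s => q s 0 i)) => //.
  near=> s; rewrite pqi//; apply: subset_itv_oo_cc.
  by near: s; exact: near_in_itvoo.
- apply: trmx_inj; have := pq tf; rewrite in_itv/= tf0 lexx => /(_ isT) ->.
  by rewrite /q subrr mexp_primitive0 oppr0 trmx0.
Unshelve. all: by end_near. Qed.

(* The row vector [(p s)^T *m mexp ((s - t) *: A)] has derivative
   [KX *m mexp ((s - t) *: A)] along a costate [p]. *)
Lemma formula_of_costate (tf : R) (p : R -> 'cV[R]_m) (t : R) :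
  costate pb tf p -> t \in `[0, tf] -> (p t)^T = costate_formula pb tf t.
Proof.
move=> [cp dp ptf]; rewrite in_itv/= => /andP[t0].
rewrite le_eqVlt => /predU1P[->|ttf].
  by rewrite ptf costate_formula_primitive// subrr mexp_primitive0 oppr0 trmx0.
apply/rowP => j; rewrite [RHS]mxE /Rintegral.
pose E (s : R) (l : 'I_m) : R := mexp ((s - t) *: cA pb) l j.
pose F (s : R) : R := ((p s)^T *m mexp ((s - t) *: cA pb)) 0 j.
have FE : F = fun s => \sum_l p s l 0 * E s l.
  by apply/funext => s; rewrite /F mxE; apply: eq_bigr => l _; rewrite mxE.
have dE (s : R) (l : 'I_m) : is_derive s 1 (E ^~ l)
    ((cA pb *m mexp ((s - t) *: cA pb)) l j).
  apply: (@is_derive_translate (fun x => mexp (x *: cA pb) l j)).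
  have := is_derive_mexp 1%:M (cA pb) l j (s - t); rewrite mul1mx.
  by under eq_fun do rewrite mul1mx.
have cE l : continuous (E ^~ l).
  move=> s; apply: differentiable_continuous; apply/derivable1_diffP.
  by have [] := dE s l.
have dF (s : R) : s \in `]t, tf[ ->
    is_derive s 1 F ((KX pb *m mexp ((s - t) *: cA pb)) 0 j).
  move=> sttf.
  have s0tf : s \in `]0, tf[.
    by move: sttf; rewrite !in_itv/= => /andP[/(le_lt_trans t0)-> ->].
  have -> : F = \sum_l (fun s => p s l 0) * (E ^~ l).
    by rewrite FE; apply/funext => r; rewrite fct_sumE.
  have -> : (KX pb *m mexp ((s - t) *: cA pb)) 0 j =
      \sum_l (p s l 0 *: (cA pb *m mexp ((s - t) *: cA pb)) l j +
        E s l *: (- ((p s)^T *m cA pb) + KX pb) 0 l).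
    have -> : KX pb *m mexp ((s - t) *: cA pb) =
        (p s)^T *m (cA pb *m mexp ((s - t) *: cA pb)) +
        (- ((p s)^T *m cA pb) + KX pb) *m mexp ((s - t) *: cA pb).
      by rewrite [in RHS]mulmxDl mulNmx mulmxA addrA subrr add0r.
    rewrite [LHS]mxE !mxE -big_split/=; apply: eq_bigr => l _.
    by rewrite [(p s)^T _ _]mxE; congr (_ + _); rewrite mulrC.
  by apply: is_derive_sum => l; apply: is_deriveM => //; exact: dp.
(* Serves the one-sided limits of [F] at both ends, where the continuity of [p] is used only from
   inside [[t, tf]]. *)
have pcvg (x : R) (G : set_system R) : Filter G -> t <= x <= tf ->
  (forall l, p s l 0 @[s --> G] --> p x l 0) -> (G --> x) ->
  F s @[s --> G] --> F x.
  move=> FG xttf pG Gx; rewrite FE; apply: cvg_finite_sum => l.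
  apply: cvgM; first exact: pG.
  by apply: (@cvg_comp _ _ _ id (E ^~ l)); [exact: Gx|exact: cE].
have cf : continuous (fun s => (KX pb *m mexp ((s - t) *: cA pb)) 0 j).
  move=> s; apply: (@continuous_comp _ _ _ (fun s => s - t)
    (fun s => (KX pb *m mexp (s *: cA pb)) 0 j)).
    by apply: cvgB; [exact: cvg_id|exact: cvg_cst].
  exact: continuous_mexp.
have cpt l : {within `[t, tf], continuous (fun s => p s l 0)}.
  apply: continuous_subspaceW (cp l) => s /=.
  by rewrite !in_itv/= => /andP[/(le_trans t0)-> ->].
rewrite (@continuous_FTC2 _ _ F)//.
- rewrite -EFinB /= /F ptf trmx0 mul0mx [in RHS]mxE subrr mexp0 mulmx1.
  by rewrite sub0r opprK.
- exact: continuous_subspaceT.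
- split=> [s sttf||]; first by have [] := dF s sttf.
  + apply: pcvg; first by rewrite lexx ltW.
      by move=> l; have /(continuous_within_itvP _ ttf)[] := cpt l.
    exact: cvg_at_right_filter.
  + apply: pcvg; first by rewrite lexx ltW.
      by move=> l; have /(continuous_within_itvP _ ttf)[] := cpt l.
    exact: cvg_at_left_filter.
- by move=> s sttf; rewrite derive1E; have [_ ->] := dF s sttf.
Qed.

End costate_representation.

(** * Duality between state and costate *)

Section integration_by_parts.
Context {R : realType}.
Notation mu := (@lebesgue_measure R).

Lemma integrable_continuousM (a b : R) (c f : R -> R) :
  {within `[a, b], continuous c} -> mu.-integrable `[a, b] (EFin \o f) ->
  mu.-integrable `[a, b] (fun t => (c t * f t)%:E).
Proof.
move=> cc intf; have mab : measurable (`[a, b]%classic : set (measurableTypeR R)).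
  exact: measurable_itv.
apply: (integrableMr mab _ _ intf).
  exact: subspace_continuous_measurable_fun.
have /compact_bounded[M [_ Mc]] :=
  continuous_compact cc (@segment_compact _ a b).
by exists M; split; rewrite ?num_real// => x Mx y aby; apply: (Mc _ Mx); exists y.
Qed.

Lemma integrable_continuous_itv (a b : R) (c : R -> R) :
  {within `[a, b], continuous c} -> mu.-integrable `[a, b] (EFin \o c).
Proof.
by move=> cc; apply: continuous_compact_integrable => //; exact: segment_compact.
Qed.

Lemma Rintegral_derive (a b : R) (p r : R -> R) : a <= b ->
  {within `[a, b], continuous p} -> {within `[a, b], continuous r} ->
  (forall t, t \in `]a, b[ -> is_derive t 1 p (r t)) ->
  Rintegral mu `[a, b] r = p b - p a.
Proof.
rewrite le_eqVlt => /predU1P[-> _ _ _|ab cp cr dp].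
  by rewrite set_itv1 Rintegral_set1 subrr.
rewrite /Rintegral (continuous_FTC2 (F := p))//.
- have /(continuous_within_itvP _ ab)[_ pa pb] := cp.
  by split=> // t tab; have [] := dp t tab.
- by move=> t tab; rewrite derive1E; have [_ ->] := dp t tab.
Qed.

(* [f] is only integrable, so the integrals are exchanged over the triangle
   [u <= s] instead. *)
Lemma Rintegral_parts (b : R) (p r f : R -> R) : 0 <= b ->
  {within `[0, b], continuous p} -> {within `[0, b], continuous r} ->
  (forall t, t \in `]0, b[ -> is_derive t 1 p (r t)) ->
  mu.-integrable `[0, b] (EFin \o f) ->
  Rintegral mu `[0, b] (fun s => r s * Rintegral mu `[0, s] f) =
  Rintegral mu `[0, b] (fun u => (p b - p u) * f u).
Proof.
move=> b0 cp cr dp intf.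
have mI (x y : R) : measurable (`[x, y]%classic : set (measurableTypeR R)).
  exact: measurable_itv.
pose f0 := f \_ `[0, b].
have intf0 : mu.-integrable setT (EFin \o f0).
  by rewrite -restrict_EFin; exact: (integrable_mkcond _ (mI 0 b)).1.
have intr := integrable_continuous_itv cr.
(* The indicator cuts out the triangle: integrating in [u] first gives the left side of the claim,
   in [s] first the right side. *)
pose F (s u : R) : R := r s * f0 u * (u <= s)%R%:R.
have intF : (mu \x mu)%E.-integrable (`[0, b]%classic `*` setT)
    (fun z => (F z.1 z.2)%:E).
  have mDT : measurable (`[0, b]%classic `*` setT :
      set (measurableTypeR R * measurableTypeR R)) by exact: measurableX.
  have int_rf := integrable_tensor (mI 0 b) intr intf0.
  apply: (le_integrable _ _ _ int_rf) => //.
  - apply/measurable_EFinP; apply: measurable_funM.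
      by apply/measurable_EFinP; exact: (measurable_int (mu \x mu)%E int_rf).
    apply: measurable_funTS.
    rewrite (_ : (fun z => _) = \1_[set z : R * R | z.2 <= z.1]); last first.
      apply/funext => z; rewrite indicE; congr (_%:R); congr nat_of_bool.
      by apply/idP/idP; rewrite inE.
    apply: measurable_indic.
    rewrite (_ : [set z | _] = (fun z : R * R => z.1 - z.2) @^-1` `[0, +oo[).
      rewrite -[X in measurable X]setTI.
      suff : measurable_fun setT
        (fun z : measurableTypeR R * measurableTypeR R => z.1 - z.2) by apply.
      by apply: measurable_funB; [exact: measurable_fst|exact: measurable_snd].
    by apply/seteqP; split=> z /=; rewrite in_itv/= andbT subr_ge0.
  - move=> z _; rewrite lee_fin /F normrM ler_piMr//.
    by case: (z.2 <= z.1); rewrite ?normr1 ?normr0.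
have inner_s (s : R) : s \in `[0, b] ->
    r s * Rintegral mu `[0, s] f = Rintegral mu setT (F s).
  rewrite in_itv/= => /andP[s0 sb].
  have sub : `[0, s] `<=` `[0, b].
    by move=> u /=; rewrite !in_itv/= => /andP[-> /le_trans->].
  have intfs := integrableS (mI 0 b) (mI 0 s) sub intf.
  rewrite -(RintegralZl _ (mI 0 s) intfs) Rintegral_mkcond.
  apply: eq_Rintegral => u _; rewrite /F /f0 !patchE !mem_setE !in_itv/=.
  have [us|su] := leP u s; last by rewrite andbF mulr0.
  by rewrite (le_trans us sb) andbT mulr1; case: ifP => // _; rewrite mulr0.
have inner_u (u : R) : u \in `[0, b] ->
    Rintegral mu `[0, b] (F ^~ u) = (p b - p u) * f u.
  move=> u0b; move: (u0b); rewrite in_itv/= => /andP[u0 ub].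
  have sub : `[u, b] `<=` `[0, b].
    by move=> s /=; rewrite !in_itv/= => /andP[/(le_trans u0)-> ->].
  have <- : Rintegral mu `[u, b] r = p b - p u.
    have cpu := continuous_subspaceW sub cp.
    have cru := continuous_subspaceW sub cr.
    have dpu (t : R) : t \in `]u, b[ -> is_derive t 1 p (r t).
      rewrite in_itv/= => /andP[ut tb].
      by apply: dp; rewrite in_itv/= tb (le_lt_trans u0).
    have H := Rintegral_derive ub cpu cru dpu.
    exact H.
  have intru := integrableS (mI 0 b) (mI u b) sub intr.
  rewrite -(RintegralZr _ (mI u b) intru).
  rewrite [LHS]Rintegral_mkcond [RHS]Rintegral_mkcond.
  apply: eq_Rintegral => s _.
  rewrite !patchE /F /f0 patchE !mem_setE u0b !in_itv/=.
  have [us|su] := leP u s; last by rewrite mulr0 if_same.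
  by rewrite (le_trans u0 us) mulr1.
have [_ _ _ eqF] := fubini_slab (mI 0 b) intF.
transitivity (Rintegral mu `[0, b] (fun s => Rintegral mu setT (F s))).
  by apply: eq_Rintegral => s; rewrite inE/=; exact: inner_s.
transitivity (Rintegral mu setT (fun u => Rintegral mu `[0, b] (F ^~ u))).
  by rewrite /Rintegral eqF.
rewrite [RHS]Rintegral_mkcond; apply: eq_Rintegral => u _.
rewrite patchE mem_setE; case: ifPn => [|u0b]; first exact: inner_u.
rewrite -[RHS]/(fine 0%E); congr fine; apply: integral0_eq => s _.
by rewrite /F /f0 patchE mem_setE (negbTE u0b) mulr0 mul0r.
Qed.

End integration_by_parts.

Section costate_duality.
Context {R : realType} {m k d : nat}.
Variable pb : problem R m k d.
Notation mu := (@lebesgue_measure R).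

Lemma integrable_sum_EFin (D : set (measurableTypeR R)) (I : Type) (s : seq I)
    (f : I -> R -> R) : measurable D ->
  (forall i, mu.-integrable D (EFin \o f i)) ->
  mu.-integrable D (fun x => (\sum_(i <- s) f i x)%:E).
Proof.
move=> mD intf; under eq_fun do rewrite -sumEFin.
by apply: integrable_sum => // i _; exact: intf.
Qed.

Lemma Rintegral_sum (D : set (measurableTypeR R)) (I : Type) (s : seq I)
    (f : I -> R -> R) : measurable D ->
  (forall i, mu.-integrable D (EFin \o f i)) ->
  Rintegral mu D (fun x => \sum_(i <- s) f i x) =
  \sum_(i <- s) Rintegral mu D (f i).
Proof.
move=> mD intf; elim: s => [|i s IH].
  by rewrite /Rintegral big_nil integral0_eq// => x _; rewrite big_nil.
rewrite big_cons -IH -(RintegralD mD (intf i)).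
  by apply: eq_Rintegral => x _; rewrite big_cons.
exact: integrable_sum_EFin.
Qed.

Lemma integrable_mulmx_entry (D : set (measurableTypeR R)) p q
    (M : 'M[R]_(p, q)) (v : R -> 'cV[R]_q) i : measurable D ->
  (forall j, mu.-integrable D (fun t => (v t j 0)%:E)) ->
  mu.-integrable D (fun t => ((M *m v t) i 0)%:E).
Proof.
move=> mD intv; under eq_fun do rewrite mxE.
by apply: integrable_sum_EFin => // j; exact: (integrableZl mD (M i j) (intv j)).
Qed.

Lemma switch_numE (p : R -> 'cV[R]_m) (t : R) :
  switch_num pb p t = KU pb - (p t)^T *m cB pb.
Proof. by rewrite /switch_num /KU [RHS]addrC addrA. Qed.

Lemma continuous_mulmx_entry (a b : R) p q (M : 'M[R]_(p, q))
    (v : R -> 'cV[R]_p) j :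
  (forall i, {within `[a, b], continuous (fun t => v t i 0)}) ->
  {within `[a, b], continuous (fun t => ((v t)^T *m M) 0 j)}.
Proof.
move=> cv; rewrite (_ : (fun t => _) = fun t => \sum_i v t i 0 * M i j).
  by move=> t; apply: cvg_finite_sum => i; apply: cvgMl; exact: cv.
by apply/funext => s; rewrite mxE; apply: eq_bigr => i _; rewrite mxE.
Qed.

Lemma continuous_switch_num (tf : R) (p : R -> 'cV[R]_m) j :
  (forall i, {within `[0, tf], continuous (fun t => p t i 0)}) ->
  {within `[0, tf], continuous (fun t => switch_num pb p t 0 j)}.
Proof.
move=> cp.
rewrite (_ : (fun t => _) = fun t => KU pb 0 j - ((p t)^T *m cB pb) 0 j).
  by move=> t; apply: cvgB; [exact: cvg_cst|exact: continuous_mulmx_entry].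
by apply/funext => t; rewrite switch_numE [LHS]mxE [X in _ + X]mxE.
Qed.

Lemma integrable_switch (tf : R) (p : R -> 'cV[R]_m) (v : R -> 'cV[R]_k) :
  (forall i, {within `[0, tf], continuous (fun t => p t i 0)}) ->
  (forall j, mu.-integrable `[0, tf] (fun t => (v t j 0)%:E)) ->
  mu.-integrable `[0, tf] (fun t => ((switch_num pb p t *m v t) 0 0)%:E).
Proof.
move=> cp intv; rewrite (_ : (fun t => _) =
  fun t => (\sum_j switch_num pb p t 0 j * v t j 0)%:E); last first.
  by apply/funext => t; rewrite mxE.
apply: integrable_sum_EFin => [|j]; first exact: measurable_itv.
by apply: integrable_continuousM; [exact: continuous_switch_num|exact: intv].
Qed.

(** Formally [p^T x] has derivative [KX x + p^T B v] and runs from [p(0)^T x0] to 0, because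
    [p tf = 0]. As [v] is only integrable and [x] is given by its integral equation,
    [Rintegral_parts] stands in for the product rule, coordinate by coordinate. *)
Lemma costate_duality (tf : R) (p : R -> 'cV[R]_m) (x : R -> 'cV[R]_m)
    (v : R -> 'cV[R]_k) : 0 <= tf -> costate pb tf p ->
  (forall i, mu.-integrable `[0, tf] (fun t => (x t i 0)%:E)) ->
  (forall j, mu.-integrable `[0, tf] (fun t => (v t j 0)%:E)) ->
  (forall t i, t \in `[0, tf] -> x t i 0 = x0 pb i 0 +
     Rintegral mu `[0, t] (fun r => (cA pb *m x r + cB pb *m v r) i 0)) ->
  Rintegral mu `[0, tf] (fun r => (KX pb *m x r + KU pb *m v r) 0 0) =
  Rintegral mu `[0, tf] (fun r => (switch_num pb p r *m v r) 0 0)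
  - ((p 0)^T *m x0 pb) 0 0.
Proof.
move=> tf0 [cp dp ptf] intx intv xE.
have mI : measurable (`[0, tf]%classic : set (measurableTypeR R)).
  exact: measurable_itv.
pose r i (s : R) : R := (- ((p s)^T *m cA pb) + KX pb) 0 i.
pose f i (s : R) : R := (cA pb *m x s + cB pb *m v s) i 0.
have cr i : {within `[0, tf], continuous (r i)}.
  rewrite (_ : r i = fun s => KX pb 0 i - ((p s)^T *m cA pb) 0 i); last first.
    by apply/funext => s; rewrite /r 2!mxE addrC.
  by move=> s; apply: cvgB; [exact: cvg_cst|exact: continuous_mulmx_entry].
have intf i : mu.-integrable `[0, tf] (EFin \o f i).
  rewrite (_ : _ \o _ =
    (fun s => ((cA pb *m x s) i 0)%:E + ((cB pb *m v s) i 0)%:E)%E); last first.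
    by apply/funext => s; rewrite /f /= mxE.
  by apply: integrableD => //; exact: integrable_mulmx_entry.
have intrx i : mu.-integrable `[0, tf] (fun s => (r i s * x s i 0)%:E).
  exact: (integrable_continuousM (cr i) (intx i)).
have intpf i : mu.-integrable `[0, tf] (fun s => (p s i 0 * f i s)%:E).
  exact: (integrable_continuousM (cp i) (intf i)).
have intr i := integrable_continuous_itv (cr i).
have parts i :
    Rintegral mu `[0, tf] (fun s => r i s * x s i 0 + p s i 0 * f i s) =
    - (p 0 i 0 * x0 pb i 0).
  rewrite (RintegralD mI (intrx i) (intpf i)).
  have intrI : mu.-integrable `[0, tf]
      (fun s => (r i s * Rintegral mu `[0, s] (f i))%:E).
    apply: integrable_continuousM => //; apply: integrable_continuous_itv.
    by apply: parameterized_integral_continuous => //; exact: intf.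
  have -> : Rintegral mu `[0, tf] (fun s => r i s * x s i 0) =
      Rintegral mu `[0, tf]
        (fun s => r i s * x0 pb i 0 + r i s * Rintegral mu `[0, s] (f i)).
    apply: eq_Rintegral => s; rewrite inE/= => s0tf.
    by rewrite (xE s i s0tf) mulrDr.
  have intrx0 : mu.-integrable `[0, tf] (fun s => (r i s * x0 pb i 0)%:E).
    exact: (integrableZr mI (x0 pb i 0) (intr i)).
  rewrite (RintegralD mI intrx0 intrI) (RintegralZr _ mI (intr i)).
  have dpi (t : R) : t \in `]0, tf[ -> is_derive t 1 (fun s => p s i 0) (r i t).
    by move=> t0tf; exact: dp.
  rewrite (Rintegral_derive tf0 (cp i) (cr i) dpi).
  rewrite (Rintegral_parts tf0 (cp i) (cr i) dpi (intf i)).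
  have -> : Rintegral mu `[0, tf] (fun u => (p tf i 0 - p u i 0) * f i u) =
      - Rintegral mu `[0, tf] (fun s => p s i 0 * f i s).
    rewrite -mulN1r -(RintegralZl _ mI (intpf i)).
    by apply: eq_Rintegral => s _; rewrite ptf mxE sub0r mulN1r mulNr.
  by rewrite ptf mxE sub0r mulNr subrK.
have int_switch := integrable_switch cp intv.
have int_sum : mu.-integrable `[0, tf]
    (fun s => (\sum_i (r i s * x s i 0 + p s i 0 * f i s))%:E).
  apply: integrable_sum_EFin => // i.
  exact: (integrableD mI (intrx i) (intpf i)).
have -> : - ((p 0)^T *m x0 pb) 0 0 =
    Rintegral mu `[0, tf] (fun s => \sum_i (r i s * x s i 0 + p s i 0 * f i s)).
  rewrite Rintegral_sum//; last first.
    by move=> i; exact: (integrableD mI (intrx i) (intpf i)).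
  by rewrite mxE -sumrN; apply: eq_bigr => i _; rewrite parts mxE.
rewrite -(RintegralD mI int_switch int_sum); apply: eq_Rintegral => s _.
have -> : \sum_i (r i s * x s i 0 + p s i 0 * f i s) =
    ((- ((p s)^T *m cA pb) + KX pb) *m x s +
      (p s)^T *m (cA pb *m x s + cB pb *m v s)) 0 0.
  rewrite [RHS]mxE !mxE -big_split/=; apply: eq_bigr => i _.
  by rewrite [(p s)^T _ _]mxE.
transitivity ((switch_num pb p s *m v s + ((- ((p s)^T *m cA pb) + KX pb) *m x s +
  (p s)^T *m (cA pb *m x s + cB pb *m v s))) 0 0); last by rewrite [LHS]mxE.
congr (fun_of_matrix _ 0 0); rewrite switch_numE.
move: (KX pb) (KU pb) => KX KU; rewrite mulmxBl mulmxDr mulmxDl mulNmx !mulmxA.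
set a := KX *m _; set b := KU *m _; set c := _ *m v s.
by rewrite [X in _ = _ + X]addrACA addNr add0r addrACA addNr addr0 addrC.
Qed.

End costate_duality.

(** * Means of the controlled state and output *)

(* [filterS] does not apply to a variable of type [R]: the filter lives on
   [measurableTypeR R]. *)
Lemma lebesgue_ae_mono (R : realType) (A B : R -> Prop) :
  (forall t, A t -> B t) -> {ae @lebesgue_measure R, forall t, A t} ->
  {ae @lebesgue_measure R, forall t, B t}.
Proof.
move=> AB [N [mN N0 AN]]; exists N; split=> // t nBt; apply: AN => At.
exact/nBt/AB.
Qed.

Lemma lebesgue_ae_mono2 (R : realType) (A B C : R -> Prop) :
  (forall t, A t -> B t -> C t) -> {ae @lebesgue_measure R, forall t, A t} ->
  {ae @lebesgue_measure R, forall t, B t} ->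
  {ae @lebesgue_measure R, forall t, C t}.
Proof.
move=> ABC nA nB; apply: negligibleS (negligibleU nA nB) => t nCt.
have [At|] := pselect (A t); last by left.
by right=> Bt; exact/nCt/ABC.
Qed.

Lemma lebesgue_ae_forall (R : realType) (I : finType) (A : R -> I -> Prop) :
  (forall i, {ae @lebesgue_measure R, forall t, A t i}) ->
  {ae @lebesgue_measure R, forall t, forall i, A t i}.
Proof.
move=> hA; have : {ae @lebesgue_measure R, forall t : measurableTypeR R,
    forall i, A t i} by exact: filter_forall.
exact.
Qed.

Section vector_processes.
Context {R : realType} {d0 : measure_display} {Omega : measurableType d0}.
Variable P : probability Omega R.
Notation mu := (@lebesgue_measure R).

Lemma ae_eq_Rintegral (D : set (measurableTypeR R)) (f g : R -> R) :
  measurable D -> mu.-integrable D (EFin \o f) ->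
  mu.-integrable D (EFin \o g) ->
  {ae mu, forall t, D t -> f t = g t} ->
  Rintegral mu D f = Rintegral mu D g.
Proof.
move=> mD intf intg fg; congr fine; apply: ae_eq_integral => //.
- exact: measurable_int intf.
- exact: measurable_int intg.
- by apply: filterS fg => t /= fgt /fgt ->.
Qed.

Definition vec_integrable (D : set (measurableTypeR R)) (n : nat)
    (Z : R -> Omega -> 'cV[R]_n) :=
  forall i, process_integrable P D (fun t w => Z t w i 0).

Lemma expectE p q (Z : Omega -> 'M[R]_(p, q)) i j :
  expect P Z i j = mean P (fun w => Z w i j).
Proof. by rewrite mxE. Qed.

Lemma expect_mulmx p q (M : 'M[R]_(p, q)) (Z : Omega -> 'cV[R]_q) i :
  (forall j, P.-integrable setT (fun w => (Z w j 0)%:E)) ->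
  P.-integrable setT (fun w => ((M *m Z w) i 0)%:E) /\
  mean P (fun w => (M *m Z w) i 0) = (M *m expect P Z) i 0.
Proof.
move=> intZ.
have intM j : P.-integrable setT (EFin \o (fun w => M i j * Z w j 0)).
  exact: (integrableZl measurableT (M i j) (intZ j)).
have ME : (fun w => (M *m Z w) i 0) = (fun w => \sum_j M i j * Z w j 0).
  by apply/funext => w; rewrite mxE.
rewrite mean_integral.
rewrite -[X in P.-integrable _ X]/(EFin \o fun w => (M *m Z w) i 0) ME.
have sumE : EFin \o (fun w => \sum_j M i j * Z w j 0) =
    (fun w => \sum_j (M i j * Z w j 0)%:E)%E.
  by apply/funext => w; rewrite /= sumEFin.
split; first by rewrite sumE; apply: integrable_sum => // j _; exact: intM.
have -> : (\int[P]_w ((M *m Z w) i 0)%:E =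
    \int[P]_w (\sum_j (M i j * Z w j 0)%:E))%E.
  by apply: eq_integral => w _; rewrite mxE sumEFin.
rewrite integral_sum// [RHS]mxE.
transitivity (fine (\sum_j (M i j * expect P Z j 0)%:E)%E); last first.
  by rewrite sumEFin.
congr fine; apply: eq_bigr => j _; rewrite expectE EFinM -meanE; last exact: intZ.
by rewrite unlock -integralZl//; exact: intZ.
Qed.

Lemma meanD (X Y : Omega -> R) : P.-integrable setT (EFin \o X) ->
  P.-integrable setT (EFin \o Y) ->
  mean P (fun w => X w + Y w) = mean P X + mean P Y.
Proof. by move=> iX iY; rewrite mean_integral; exact: RintegralD. Qed.

Lemma mean_cst (c : R) : mean P (fun=> c) = c.
Proof.
rewrite mean_integral -[X in fine X]/(\int[P]_w cst c%:E w)%E.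
by rewrite integral_cst//= probability_setT mule1.
Qed.

Lemma vec_integrable_mulmx (D : set (measurableTypeR R)) p q
    (M : 'M[R]_(p, q)) (Z : R -> Omega -> 'cV[R]_q) i : measurable D ->
  vec_integrable D Z -> process_integrable P D (fun t w => (M *m Z t w) i 0).
Proof.
move=> mD intZ; rewrite (_ : (fun t w => _) =
    (fun t w => \sum_j M i j * Z t w j 0)).
  apply: process_integrable_sum => // j.
  exact: (process_integrableZl (M i j) mD (intZ j)).
by apply/funext => t; apply/funext => w; rewrite mxE.
Qed.

Lemma ae_vec_integrable (D : set (measurableTypeR R)) n
    (Z : R -> Omega -> 'cV[R]_n) : measurable D -> vec_integrable D Z ->
  {ae mu, forall t, D t -> forall i,
    P.-integrable setT (fun w => (Z t w i 0)%:E)}.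
Proof.
move=> mD intZ.
have : {ae mu, forall t, forall i, D t ->
    P.-integrable setT (fun w => (Z t w i 0)%:E)}.
  by apply: filter_forall => i; have [] := mean_process_integrable mD (intZ i).
by apply: filterS => t Zt Dt i; exact: Zt.
Qed.

Lemma integrable_expect (D : set (measurableTypeR R)) n
    (Z : R -> Omega -> 'cV[R]_n) : measurable D -> vec_integrable D Z ->
  forall i, mu.-integrable D (fun t => (expect P (Z t) i 0)%:E).
Proof.
move=> mD intZ i; under eq_fun do rewrite expectE.
by have [] := mean_process_integrable mD (intZ i).
Qed.

End vector_processes.

Section controlled_means.
Context {R : realType} {m k d : nat} {d0 : measure_display}
  {Omega : measurableType d0}.
Variables (pb : problem R m k d) (P : probability Omega R)
  (W : 'I_d -> R -> Omega -> R).
Hypothesis P_complete : measure_is_complete P.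
Hypothesis W_brownian : standard_brownian P W.
Notation mu := (@lebesgue_measure R).
Let T := horizon pb.
Variables (u : R -> Omega -> 'cV[R]_k) (X : R -> Omega -> 'cV[R]_m)
  (Y : R -> Omega -> R).
Hypothesis u_control : control pb P W u.
Hypothesis XY_state : state_eq pb P W u X Y.

Let mT : measurable (`[0, T]%classic : set (measurableTypeR R)).
Proof. exact: measurable_itv. Qed.

Lemma vec_integrable_control : vec_integrable P `[0, T] u.
Proof.
by case: u_control => _ L2u i; exact: L2_adapted_process_integrable (L2u i).
Qed.

Lemma vec_integrable_state : vec_integrable P `[0, T] X.
Proof.
case: XY_state => stX _ i; have [L2X _ _ _] := stX i.
exact: L2_adapted_process_integrable L2X.
Qed.

Let bproc (t : R) (w : Omega) : 'cV[R]_m := b pb (X t w) (u t w).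

Lemma vec_integrable_drift : vec_integrable P `[0, T] bproc.
Proof.
move=> i; rewrite (_ : (fun t w => _) =
    fun t w => (cA pb *m X t w) i 0 + (cB pb *m u t w) i 0).
  apply: process_integrableD => //; apply: vec_integrable_mulmx => //.
    exact: vec_integrable_state.
  exact: vec_integrable_control.
by apply/funext => t; apply/funext => w; rewrite /bproc /b mxE.
Qed.

(** Linearity of the mean uses integrability of [X t] and [u t], which Fubini yields for almost
    every [t]; this suffices under a time integral. *)
Lemma ae_expect_drift : {ae mu, forall t, `[0, T]%classic t -> forall i,
  expect P (bproc t) i 0 =
  (cA pb *m expect P (X t) + cB pb *m expect P (u t)) i 0}.
Proof.
have := ae_vec_integrable mT vec_integrable_control.
have := ae_vec_integrable mT vec_integrable_state.
apply: filterS2 => t intX intu t0T i.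
have [iA mA] := expect_mulmx (cA pb) i (intX t0T).
have [iB mB] := expect_mulmx (cB pb) i (intu t0T).
rewrite expectE [RHS]mxE -mA -mB -meanD//.
by congr (mean _ _); apply/funext => w; rewrite /bproc /b mxE.
Qed.

Lemma expect_state (t : R) i : t \in `[0, T] -> expect P (X t) i 0 = x0 pb i 0 +
  Rintegral mu `[0, t]
    (fun r => (cA pb *m expect P (X r) + cB pb *m expect P (u r)) i 0).
Proof.
move=> t0T; case: XY_state => stX _.
have [_ XE] := mean_ito_process P_complete W_brownian (stX i)
  (vec_integrable_drift i) t0T.
rewrite expectE XE; congr (_ + _).
have mt : measurable (`[0, t]%classic : set (measurableTypeR R)).
  exact: measurable_itv.
have sub : `[0, t] `<=` `[0, T].
  move=> r /=; move: t0T; rewrite !in_itv/= => /andP[_ tT] /andP[-> rt].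
  exact: le_trans rt tT.
have ae_t : {ae mu, forall r, `[0, t]%classic r ->
    mean P (fun w => bproc r w i 0) =
    (cA pb *m expect P (X r) + cB pb *m expect P (u r)) i 0}.
  apply: lebesgue_ae_mono ae_expect_drift => r bE r0t.
  by rewrite -bE ?expectE//; exact: sub.
apply: ae_eq_Rintegral ae_t => //.
- apply: (integrableS mT mt sub).
  by have [] := mean_process_integrable mT (vec_integrable_drift i).
- apply: (integrableS mT mt sub).
  rewrite (_ : _ \o _ = fun r => (((cA pb *m expect P (X r)) i 0)%:E +
      ((cB pb *m expect P (u r)) i 0)%:E)%E); last first.
    by apply/funext => r; rewrite /= mxE.
  apply: integrableD => //; apply: integrable_mulmx_entry => //.
    exact: integrable_expect vec_integrable_state.
  exact: integrable_expect vec_integrable_control.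
Qed.

Lemma integrable_G : mu.-integrable `[0, T] (EFin \o G pb P u X).
Proof.
rewrite (_ : _ \o _ = fun r => (((KX pb *m expect P (X r)) 0 0)%:E +
    ((KU pb *m expect P (u r)) 0 0)%:E)%E); last first.
  by apply/funext => r; rewrite /= /G mxE.
apply: integrableD => //; apply: integrable_mulmx_entry => //.
  exact: integrable_expect vec_integrable_state.
exact: integrable_expect vec_integrable_control.
Qed.

Let hproc (t : R) (w : Omega) : R :=
  h pb (expect P (X t)) (X t w) (expect P (bproc t)) (u t w).

Let hprocE (t : R) (w : Omega) : hproc t w =
  ((E1 pb)^T *m expect P (X t)) 0 0 + ((E3 pb)^T *m expect P (bproc t)) 0 0 +
  (((E2 pb)^T *m X t w) 0 0 + ((E4 pb)^T *m u t w) 0 0).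
Proof.
by rewrite /hproc /h !mxE; ring.
Qed.

Lemma process_integrable_output_drift : process_integrable P `[0, T] hproc.
Proof.
rewrite (_ : hproc = fun t w => ((E1 pb)^T *m expect P (X t)) 0 0 +
    ((E3 pb)^T *m expect P (bproc t)) 0 0 +
  (((E2 pb)^T *m X t w) 0 0 + ((E4 pb)^T *m u t w) 0 0)); last first.
  by apply/funext => t; apply/funext => w; exact: hprocE.
apply: process_integrableD => //; apply: process_integrableD => //.
- apply: process_integrable_deterministic => //.
  apply: integrable_mulmx_entry => //.
  exact: integrable_expect vec_integrable_state.
- apply: process_integrable_deterministic => //.
  apply: integrable_mulmx_entry => //.
  exact: integrable_expect vec_integrable_drift.
- exact: vec_integrable_mulmx vec_integrable_state.
- exact: vec_integrable_mulmx vec_integrable_control.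
Qed.

(** Through [ae_expect_drift], the [E3] term supplies the summand with [cA] in [KX] and the one with
    [cB] in [KU]. *)
Lemma ae_mean_output_drift : {ae mu, forall t, `[0, T]%classic t ->
  mean P (hproc t) = G pb P u X t}.
Proof.
have := ae_expect_drift.
have := ae_vec_integrable mT vec_integrable_control.
have := ae_vec_integrable mT vec_integrable_state.
apply: filterS3 => t intX intu bE t0T.
have [iA mA] := expect_mulmx (E2 pb)^T 0 (intX t0T).
have [iB mB] := expect_mulmx (E4 pb)^T 0 (intu t0T).
rewrite (_ : hproc t = fun w => ((E1 pb)^T *m expect P (X t)) 0 0 +
    ((E3 pb)^T *m expect P (bproc t)) 0 0 +
  (((E2 pb)^T *m X t w) 0 0 + ((E4 pb)^T *m u t w) 0 0)); last first.
  by apply/funext => w; exact: hprocE.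
rewrite meanD//; last 2 first.
- exact: finite_measure_integrable_cst.
- exact: (integrableD measurableT iA iB).
rewrite (meanD iA iB) mA mB mean_cst.
have -> : expect P (bproc t) = cA pb *m expect P (X t) + cB pb *m expect P (u t).
  by apply/colP => i; exact: bE.
rewrite /G /KX /KU !mulmxDl mulmxDr !mulmxA !mxE.
set a := \sum_j _; set b1 := \sum_j _; set c := \sum_j _; set e := \sum_j _.
set f := \sum_j _; ring.
Qed.

Lemma integrable_output (t : R) : t \in `[0, T] ->
  P.-integrable setT (EFin \o Y t).
Proof.
case: XY_state => _ stY t0T.
by have [] := mean_ito_process P_complete W_brownian stY
  process_integrable_output_drift t0T.
Qed.

Lemma mean_output (t : R) : t \in `[0, T] ->
  mean P (Y t) = y0 pb + Rintegral mu `[0, t] (G pb P u X).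
Proof.
move=> t0T; case: XY_state => _ stY.
have [_ ->] := mean_ito_process P_complete W_brownian stY
  process_integrable_output_drift t0T.
congr (_ + _).
have mt : measurable (`[0, t]%classic : set (measurableTypeR R)).
  exact: measurable_itv.
have sub : `[0, t] `<=` `[0, T].
  move=> r /=; move: t0T; rewrite !in_itv/= => /andP[_ tT] /andP[-> rt].
  exact: le_trans rt tT.
have ae_t : {ae mu, forall r, `[0, t]%classic r ->
    mean P (hproc r) = G pb P u X r}.
  by apply: lebesgue_ae_mono ae_mean_output_drift => r hE /sub; exact: hE.
apply: ae_eq_Rintegral ae_t => //.
- apply: (integrableS mT mt sub).
  by have [] := mean_process_integrable mT process_integrable_output_drift.
- exact: (integrableS mT mt sub integrable_G).
Qed.

(** Continuity comes from the integral form of the mean, not from continuity of the paths. *)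
Lemma continuous_mean_output :
  {within `[0, T], continuous (fun t => mean P (Y t))}.
Proof.
apply: (@subspace_eq_continuous R `[0, T] R
    (fun t : R => y0 pb + Rintegral mu `[0, t] (G pb P u X))).
  by move=> t t0T; rewrite /from_subspace mean_output//; move: t0T; rewrite inE.
have [T0|T0] := leP 0 T.
  move=> t; apply: cvgD; first exact: cvg_cst.
  exact: (parameterized_integral_continuous T0 integrable_G).
by rewrite set_itv_ge -?ltNge//; exact: continuous_subspace0.
Qed.

End controlled_means.

(** * The hitting time *)

Section hitting_time.
Context {R : realType}.
Notation mu := (@lebesgue_measure R).

Lemma within_continuous_dist (a b : R) (y : R -> R) (x e : R) :
  {within `[a, b], continuous y} -> x \in `[a, b] -> 0 < e ->
  exists2 r : R, 0 < r &
    forall z, z \in `[a, b] -> `|x - z| < r -> `|y x - y z| < e.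
Proof.
move=> /subspace_continuousP cy xab e0.
have /cvgrPdist_lt/(_ _ e0) := cy x xab.
rewrite near_withinE => /nbhs_ballP[r /= r0 xr]; exists r => // z zab xz.
exact: xr.
Qed.

(* If [f x] were positive, [y] would grow at rate at least [f x / 2] just before
   [x]. *)
Lemma lebesgue_pt_le0 (T c : R) (f y : R -> R) (x : R) :
  mu.-integrable `[0, T] (EFin \o f) ->
  (forall t, t \in `[0, T] -> y t = c + Rintegral mu `[0, t] f) ->
  0 < x < T -> (forall t, 0 <= t < x -> y x <= y t) ->
  lebesgue_pt f x -> f x <= 0.
Proof.
move=> intf yE /andP[x0 xT] yx pt_x; rewrite leNgt; apply/negP => fx0.
have mI (i : interval R) : measurable ([set` i] : set (measurableTypeR R)).
  exact: measurable_itv.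
(* The ball has length [2 * r] and its left half [J] length [r]: a mean deviation below [f x / 4] on
   the ball costs less than [r * f x / 2] on [J], so the integral of [f] over [J] would exceed
   [r * f x / 2]. *)
have fx4 : (0 < (f x / 4)%:E)%E by rewrite lte_fin divr_gt0.
have [r [r0 rx rT davg_r]] : exists r : R, [/\ 0 < r, r < x, r < T - x &
    (davg f x r < (f x / 4)%:E)%E].
  near (0:R)^'+ => r; exists r; split; near: r.
  - exact: nbhs_right_gt.
  - exact: nbhs_right_lt.
  - by apply: nbhs_right_lt; rewrite subr_gt0.
  - have /fine_cvgP[fin_d /cvgrPdist_lt/(_ (f x / 4))] := pt_x.
    move=> /(_ _)/(fun h => h (divr_gt0 fx0 (ltr0n _ 4))) close_d.
    near=> r; rewrite -(@fineK _ (davg f x r)); last by near: r; exact: fin_d.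
    rewrite lte_fin (le_lt_trans (ler_norm _))// -normrN -[- _]sub0r.
    by near: r; exact: close_d.
have sub_ball : ball x r `<=` `[0, T].
  move=> t; rewrite ball_itv/= !in_itv/= => /andP[xrt txr]; apply/andP; split.
    by rewrite ltW// (lt_trans _ xrt)// subr_gt0.
  by rewrite ltW// (lt_trans txr)// -ltrBrDl.
have mball : measurable (ball x r : set (measurableTypeR R)).
  exact: measurable_ball.
pose J : set (measurableTypeR R) := `]x - r, x]%classic.
have mJ : measurable J by exact: measurable_itv.
have subJ : J `<=` ball x r.
  move=> t; rewrite ball_itv/J/= !in_itv/= => /andP[-> tx] /=.
  by rewrite (le_lt_trans tx)// ltrDl.
have intfb : mu.-integrable (ball x r) (EFin \o f).
  exact: integrableS intf.
have mu_ball : mu (ball x r) = (r *+ 2)%:E.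
  by rewrite (lebesgue_measure_ball _ (ltW r0)).
have int_cst (A : set (measurableTypeR R)) (a : R) : measurable A ->
    (mu A < +oo)%E -> mu.-integrable A (EFin \o cst a).
  move=> mA finA; apply: measurable_bounded_integrable => //.
  by exists `|a|; split; [exact: num_real|move=> M aM t _; exact: ltW].
pose dev t := `|f t - f x|.
have intdev : mu.-integrable (ball x r) (EFin \o dev).
  have intc : mu.-integrable (ball x r) (EFin \o cst (f x)).
    by apply: int_cst => //; rewrite mu_ball ltry.
  exact: (integrable_abse (integrableB mball intfb intc)).
have intdev_lt : Rintegral mu (ball x r) dev < r * f x / 2.
  have : (\int[mu]_(t in ball x r) (dev t)%:E = (r *+ 2)%:E * davg f x r)%E.
    have r2 : r *+ 2 != 0 by rewrite mulrn_eq0/= gt_eqF.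
    rewrite /davg /iavg mu_ball inver (negbTE r2) muleA -EFinM.
    by rewrite divff// mul1e.
  rewrite /Rintegral => ->; have d_fin : davg f x r \is a fin_num.
    by rewrite ge0_fin_numE ?davg_ge0// (lt_trans davg_r)// ltry.
  rewrite fineM//=; have : fine (davg f x r) < f x / 4.
    by rewrite -lte_fin fineK.
  by rewrite -(ltr_pM2l r0); lra.
have xrT : x - r \in `[0, T].
  by rewrite in_itv/= subr_ge0 ltW//= lerBlDl ler_wpDl// ltW.
have xT' : x \in `[0, T] by rewrite in_itv/= !ltW.
have intJ : mu.-integrable J (EFin \o f) by exact: integrableS intfb.
(* This integral is the increment [y x - y (x - r)]. *)
have Jle0 : Rintegral mu J f <= 0.
  have int0x : mu.-integrable `[0, x] (EFin \o f).
    apply: integrableS intf => // t /=; rewrite !in_itv/= => /andP[-> tx].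
    by rewrite (le_trans tx)// ltW.
  have /(_ (x - r)) := Rintegral_itvB int0x.
  rewrite !bnd_simp/= => <-; last 2 first.
  - by rewrite subr_ge0 ltW.
  - by rewrite gerBl ltW.
  have := yx (x - r); rewrite subr_ge0 (ltW rx) ltrBlDr ltrDl r0 => /(_ isT).
  by rewrite (yE _ xrT) (yE _ xT') lerD2l subr_le0.
have intdevJ : mu.-integrable J (EFin \o dev) by exact: integrableS intdev.
have intcJ : mu.-integrable J (EFin \o cst (f x)).
  apply: int_cst => //.
  by rewrite lebesgue_measure_itv/=; case: ifP; rewrite ltry.
have : Rintegral mu J (fun t => f x - dev t) <= Rintegral mu J f.
  apply: le_Rintegral => //; first exact: (integrableB mJ intcJ intdevJ).
  by move=> t _; rewrite lerBlDr -lerBlDl /dev distrC; exact: ler_norm.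
rewrite (RintegralB mJ intcJ intdevJ).
rewrite Rintegral_cst//.
have -> : fine (mu J) = r.
  rewrite lebesgue_measure_itv/= lte_fin ltrBlDr ltrDl r0 -EFinD/=.
  by rewrite opprB addrC subrK.
have : Rintegral mu J dev <= Rintegral mu (ball x r) dev.
  apply: fine_le.
  - exact: integrable_fin_num.
  - exact: integrable_fin_num.
  apply: ge0_subset_integral => //; first exact: measurable_int intdev.
  by move=> t _; rewrite lee_fin; exact: normr_ge0.
by move: intdev_lt Jle0; have := mulr_gt0 r0 fx0; lra.
Unshelve. all: by end_near. Qed.

Section hitting_time_of_the_mean.
Context {m k d : nat} {d0 : measure_display} {Omega : measurableType d0}.
Variables (pb : problem R m k d) (P : probability Omega R)
  (Y : R -> Omega -> R) (y : R -> R).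
Let T := horizon pb.
Hypothesis T0 : 0 < T.
Hypothesis yE : forall t, t \in `[0, T] -> ('E_P[Y t] = (y t)%:E)%E.
Hypothesis cy : {within `[0, T], continuous y}.
Let hit : set R := [set t | t \in `[0%R, T] /\ ('E_P[Y t] <= 0)%E].
Let I := ereal_inf [set t%:E | t in hit].

Let I0 : (0 <= I)%E.
Proof.
apply: le_ereal_inf_tmp => _ [t [+ _] <-].
by rewrite in_itv/= lee_fin => /andP[].
Qed.

(** The minimum lies between 0 and [T], so [fine] loses nothing, even when there is no hitting time
    and [I] is infinite. *)
Let tauE : ((tau pb P Y)%:E = mine I T%:E)%E.
Proof.
rewrite fineK// ge0_fin_numE.
  by rewrite (@le_lt_trans _ _ T%:E) ?ltry// ge_min lexx orbT.
by rewrite le_min I0 lee_fin ltW.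
Qed.

Lemma tau_ge0 : 0 <= tau pb P Y.
Proof. by rewrite -lee_fin tauE le_min I0 lee_fin ltW. Qed.

Lemma tau_le_hit (t : R) : t \in `[0, T] -> y t <= 0 -> tau pb P Y <= t.
Proof.
move=> t0T yt0; rewrite -lee_fin tauE ge_min; apply/orP; left.
apply: ereal_inf_lbound; exists t => //; split => //.
by rewrite yE// lee_fin.
Qed.

(** Below [T] the truncation is inactive, so [tau] is the infimum of the hitting times. If [y] were
    positive there, continuity would keep every hitting time at least [r] beyond it. *)
Lemma mean_at_tau_le0 : tau pb P Y < T -> y (tau pb P Y) <= 0.
Proof.
move=> tauT; rewrite leNgt; apply/negP => y0.
have IE : I = (tau pb P Y)%:E.
  move: tauE; rewrite minEle; case: ifPn => // _ [] tauT'.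
  by rewrite tauT' ltxx in tauT.
have tau0T : tau pb P Y \in `[0, T] by rewrite in_itv/= tau_ge0 ltW.
have [r r0 yr] := within_continuous_dist cy tau0T y0.
suff : ((tau pb P Y + r)%:E <= I)%E.
  by rewrite IE lee_fin gerDl leNgt r0.
apply: le_ereal_inf_tmp => _ [t [t0T Yt] <-]; rewrite lee_fin leNgt.
apply/negP => tr; have yt0 : y t <= 0 by rewrite -lee_fin -yE.
have taut := tau_le_hit t0T yt0.
have := yr t t0T; rewrite distrC ger0_norm ?subr_ge0// ltrBlDl => /(_ tr).
rewrite ltNge ger0_norm ?subr_ge0 ?(le_trans yt0 (ltW y0))//.
by rewrite lerDl oppr_ge0 yt0.
Qed.

(** A negative value persists just to the left of [t], which gives an earlier hitting time;
    [0 < y 0] excludes [t = 0]. *)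
Lemma tau_lt_hit (t : R) : t \in `[0, T] -> 0 < y 0 -> y t < 0 ->
  tau pb P Y < t.
Proof.
move=> t0T y00 yt0; have [t0 tT] : 0 < t /\ t <= T.
  move: (t0T); rewrite in_itv/= le_eqVlt => /andP[/orP[/eqP t0|//] _].
  by move: yt0; rewrite -t0 ltNge ltW.
have Nyt : 0 < - y t by rewrite oppr_gt0.
have [r r0 yr] := within_continuous_dist cy t0T Nyt.
(* The maximum keeps [s] in [[0, T]]; half of [r] keeps it strictly within the continuity radius. *)
pose s := Num.max 0 (t - r / 2).
have st : s < t by rewrite /s gt_max t0 ltrBlDr ltrDl divr_gt0.
have s0T : s \in `[0, T].
  by rewrite in_itv/= le_max lexx /= (le_trans (ltW st)).
apply: (le_lt_trans _ st); apply: tau_le_hit => //.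
have ts0 : 0 <= t - s by rewrite subr_ge0 ltW.
have := yr s s0T; rewrite (ger0_norm ts0).
have tsr : t - s < r.
  rewrite ltrBlDr -ltrBlDl lt_max; apply/orP; right.
  by rewrite ltrD2l ltrN2 ltr_pdivrMr// mulr_natr mulr2n ltrDl.
by move=> /(_ tsr); rewrite ltr_norml => /andP[]; lra.
Qed.

End hitting_time_of_the_mean.

End hitting_time.

(** * The maximum principle *)

Section modified_control.
Context {R : realType} {m k d : nat} {d0 : measure_display}
  {Omega : measurableType d0}.
Variables (pb : problem R m k d) (P : probability Omega R)
  (W : 'I_d -> R -> Omega -> R) (u : R -> Omega -> 'cV[R]_k).
Notation mu := (@lebesgue_measure R).
Let F := augmented_filtration P W.
Let T := horizon pb.
Variables (tf : R) (S : R -> 'rV[R]_k) (c : 'cV[R]_k).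

(** Change of [S t *m u t w] when [u t w] is replaced by [c], so that negative values favour [c].
    The value 0 outside [[0, tf]] leaves [u] untouched there. *)
Definition gain (t : R) (w : Omega) : R :=
  if t \in `[0, tf] then (S t *m (c - u t w)) 0 0 else 0.

(* The competitor in the optimality argument. *)
Definition modified_control (t : R) (w : Omega) : 'cV[R]_k :=
  if gain t w < 0 then c else u t w.

Hypothesis u_control : control pb P W u.
Hypothesis cS : forall j, {within `[0, tf], continuous (fun t => S t 0 j)}.
Hypothesis Uc : U pb c.

Let s j : R -> R := (fun t => S t 0 j) \_ `[0, tf].

Let gainE (t : R) (w : Omega) : gain t w = \sum_j s j t * (c j 0 - u t w j 0).
Proof.
rewrite /gain; case: ifPn => t0tf.
  rewrite mxE; apply: eq_bigr => j _; rewrite /s patchE mem_setE t0tf.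
  by rewrite 2!mxE.
by rewrite big1// => j _; rewrite /s patchE mem_setE (negbTE t0tf) mul0r.
Qed.

(** The general source space serves twice: time and sample jointly for joint measurability, and
    [Omega] with the sigma-algebra of time [t] for adaptedness. *)
Let measurable_modified d' (T' : measurableType d') (D : set T')
    (time : T' -> R) (point : T' -> Omega) i : measurable D ->
  (forall j, measurable_fun D (fun z => s j (time z))) ->
  (forall j, measurable_fun D (fun z => u (time z) (point z) j 0)) ->
  measurable_fun D (fun z => modified_control (time z) (point z) i 0).
Proof.
move=> mD ms mu_; rewrite (_ : (fun z => _) = fun z =>
  if gain (time z) (point z) < 0 then c i 0 else u (time z) (point z) i 0).
  apply: measurable_fun_if => //.
  - apply: measurable_fun_ltr => //; under eq_fun do rewrite gainE.
    apply: measurable_sum => j; apply: measurable_funM => //.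
    exact: measurable_funB.
  - apply: measurable_funS (mu_ i) => //; exact: subIsetl.
by apply/funext => z; rewrite /modified_control; case: ifP.
Qed.

Lemma control_modified : control pb P W modified_control.
Proof.
have [uU L2u] := u_control; split=> [t w t0T|i].
  by rewrite /modified_control; case: ifP => // _; exact: uU.
have mDT : measurable (`[0, T]%classic `*` [set: Omega] :
  set (measurableTypeR R * Omega)) by exact: measurableX.
have msT j : measurable_fun [set: measurableTypeR R] (s j).
  have mtf : measurable (`[0, tf]%classic : set (measurableTypeR R)).
    exact: measurable_itv.
  apply/(measurable_restrictT _ mtf).
  by apply: subspace_continuous_measurable_fun; [exact: mtf|exact: cS].
have mv : measurable_fun (`[0, T]%classic `*` [set: Omega] :
    set (measurableTypeR R * Omega)) (fun z => modified_control z.1 z.2 i 0).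
  apply: measurable_modified => // j; last by have [] := L2u j.
  apply: measurable_funTS; exact: measurableT_comp (msT j) measurable_fst.
split.
- exact: mv.
- move=> t t0T; pose Ft := g_sigma_algebraType
    (natural_gen W t `|` P.-negligible).
  suff : measurable_fun [set: Ft] (fun w => modified_control t w i 0).
    by move=> mvt B mB; have := mvt measurableT _ mB; rewrite setTI.
  apply: (@measurable_modified _ Ft setT (fun=> t) id) => // j.
  by move=> _ B mB; rewrite setTI; have [_ /(_ _ t0T) + _] := L2u j; exact.
- have [mui _ L2ui] := L2u i.
  have {}mui : measurable_fun (`[0, T]%classic `*` [set: Omega] :
    set (measurableTypeR R * Omega)) (fun z => u z.1 z.2 i 0) by exact: mui.
  have mT : measurable (`[0, T]%classic : set (measurableTypeR R)).
    exact: measurable_itv.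
  rewrite -(@ge0_integral_slab _ _ _ _ _ mu P `[0, T]%classic
    (fun t w => (modified_control t w i 0) ^+ 2))//; last first.
  - by move=> t w; exact: sqr_ge0.
  - exact: measurable_funX.
  (* Each value is that of [c] or of [u], so its square is at most the sum of both squares. *)
  apply: (@le_lt_trans _ _ (\int[(mu \x P)%E]_(z in `[0%R, T]%classic `*` setT)
    (((c i 0) ^+ 2)%:E + ((u z.1 z.2 i 0) ^+ 2)%:E))%E).
    apply: ge0_le_integral => //=.
    + by move=> z _; rewrite lee_fin sqr_ge0.
    + by apply/measurable_EFinP; exact: measurable_funX.
    + apply: emeasurable_funD => //.
      by apply/measurable_EFinP; exact: measurable_funX.
    + move=> z _; rewrite -EFinD lee_fin /modified_control.
      by case: ifP => _; rewrite ?lerDl ?lerDr sqr_ge0.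
  rewrite ge0_integralD//=; last 3 first.
  + by move=> z _; rewrite lee_fin sqr_ge0.
  + by move=> z _; rewrite lee_fin sqr_ge0.
  + by apply/measurable_EFinP; exact: measurable_funX.
  rewrite lte_add_pinfty//.
    rewrite integral_cst//.
    rewrite -[X in (_ * X)%E]/((mu \x P)%E (`[0%R, T]%classic `*` setT)).
    rewrite product_measure1E//= probability_setT mule1.
    rewrite lebesgue_measure_itv/=.
    by case: ifP => _; rewrite -?EFinD -?EFinM ?mule0 ltry.
  rewrite (@ge0_integral_slab _ _ _ _ _ mu P `[0, T]%classic
    (fun t w => (u t w i 0) ^+ 2))//; last first.
  - by move=> t w; exact: sqr_ge0.
  - exact: measurable_funX.
Qed.

Lemma modified_controlB (t : R) (w : Omega) : t \in `[0, tf] ->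
  (S t *m modified_control t w) 0 0 - (S t *m u t w) 0 0 =
  Num.min (gain t w) 0.
Proof.
move=> t0tf; rewrite /modified_control /gain t0tf.
case: ltP => [g0|g0]; last by rewrite subrr.
by rewrite mulmxBr [RHS]mxE [X in _ = _ + X]mxE.
Qed.

End modified_control.

Lemma ae_eq0_of_nonpos {R : realType} d (T : measurableType d)
    (mu : {measure set T -> \bar R}) (D : set T) (f : T -> R) :
  measurable D -> mu.-integrable D (EFin \o f) ->
  {ae mu, forall x, D x -> f x <= 0} -> 0 <= Rintegral mu D f ->
  {ae mu, forall x, D x -> f x = 0}.
Proof.
move=> mD intf f_le0 If_ge0; have mf := measurable_int mu intf.
have absE : (\int[mu]_(x in D) `|(EFin \o f) x| =
    \int[mu]_(x in D) (- (f x)%:E))%E.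
  apply: ae_eq_integral => //.
  - exact: measurableT_comp.
  - exact: measurableT_comp.
  - by apply: filterS f_le0 => x fx Dx /=; rewrite ler0_norm ?fx.
have abs0 : (\int[mu]_(x in D) `|(EFin \o f) x| = 0)%E.
  apply/eqP; rewrite eq_le integral_ge0 ?andbT//.
  rewrite absE integralN; last exact: integrable_add_def.
  rewrite -(fineK (integrable_fin_num mD intf)) -EFinN lee_fin oppr_le0.
  exact: If_ge0.
have := (ae_eq_integral_abs mu mD mf).1 abs0.
by apply: filterS => x fx /fx [].
Qed.

Section maximum_principle.
Context {R : realType} {m k d : nat} {d0 : measure_display}
  {Omega : measurableType d0}.
Variables (pb : problem R m k d) (P : probability Omega R)
  (W : 'I_d -> R -> Omega -> R).
Hypothesis P_complete : measure_is_complete P.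
Hypothesis W_brownian : standard_brownian P W.
Notation mu := (@lebesgue_measure R).
Let T := horizon pb.
Variables (tf : R) (p : R -> 'cV[R]_m).
Hypothesis tf0 : 0 <= tf.
Hypothesis tfT : tf <= T.
Hypothesis p_costate : costate pb tf p.

Let mtf : measurable (`[0, tf]%classic : set (measurableTypeR R)).
Proof. exact: measurable_itv. Qed.

Let mT : measurable (`[0, T]%classic : set (measurableTypeR R)).
Proof. exact: measurable_itv. Qed.

Let sub_tf : `[0, tf]%classic `<=` (`[0, T]%classic : set (measurableTypeR R)).
Proof.
by move=> t /=; rewrite !in_itv/= => /andP[-> ttf]; exact: le_trans ttf tfT.
Qed.

Lemma vec_integrable_control_tf (u : R -> Omega -> 'cV[R]_k) :
  control pb P W u -> vec_integrable P `[0, tf] u.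
Proof.
move=> /vec_integrable_control intu i.
exact: process_integrableS mT mtf sub_tf (intu i).
Qed.

Lemma mean_output_duality (u : R -> Omega -> 'cV[R]_k)
    (X : R -> Omega -> 'cV[R]_m) (Y : R -> Omega -> R) :
  control pb P W u -> state_eq pb P W u X Y ->
  mean P (Y tf) = y0 pb - ((p 0)^T *m x0 pb) 0 0 +
    Rintegral mu `[0, tf] (fun t => (switch_num pb p t *m expect P (u t)) 0 0).
Proof.
move=> cu st; have tf0T : tf \in `[0, T] by rewrite in_itv/= tf0.
rewrite (mean_output P_complete W_brownian cu st tf0T) -addrA; congr (_ + _).
rewrite addrC -(costate_duality (x := fun t => expect P (X t)) tf0 p_costate)//.
- move=> i; have intX := integrable_expect mT (vec_integrable_state st) i.
  exact: (integrableS mT mtf sub_tf intX).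
- exact: integrable_expect (vec_integrable_control_tf cu).
- move=> t i t0tf; apply: (expect_state P_complete W_brownian cu st).
  exact: sub_tf.
Qed.

(* Passing from [u] to the modified control can only decrease the integrand of
   [mean_output_duality], so by optimality it does not decrease it at all. *)
Lemma switch_num_ge0 (u : R -> Omega -> 'cV[R]_k)
    (X : (R -> Omega -> 'cV[R]_k) -> R -> Omega -> 'cV[R]_m)
    (Y : (R -> Omega -> 'cV[R]_k) -> R -> Omega -> R) (c : 'cV[R]_k) :
  (forall v, control pb P W v -> state_eq pb P W v (X v) (Y v)) ->
  control pb P W u ->
  (forall v, control pb P W v -> mean P (Y u tf) <= mean P (Y v tf)) ->
  U pb c ->
  {ae mu, forall t, t \in `[0, tf] -> {ae P, forall w,
    0 <= (switch_num pb p t *m (c - u t w)) 0 0}}.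
Proof.
move=> st cu opt Uc; have [cp _ _] := p_costate.
pose S := switch_num pb p; pose v := modified_control u tf S c.
have cS j : {within `[0, tf], continuous (fun t => S t 0 j)}.
  exact: continuous_switch_num.
have cv : control pb P W v by exact: control_modified.
pose drop t : R := (S t *m expect P (v t)) 0 0 - (S t *m expect P (u t)) 0 0.
have intSv : mu.-integrable `[0, tf] (fun t => ((S t *m expect P (v t)) 0 0)%:E).
  apply: integrable_switch => //.
  exact: integrable_expect (vec_integrable_control_tf cv).
have intSu : mu.-integrable `[0, tf] (fun t => ((S t *m expect P (u t)) 0 0)%:E).
  apply: integrable_switch => //.
  exact: integrable_expect (vec_integrable_control_tf cu).
have intdrop : mu.-integrable `[0, tf] (EFin \o drop).
  exact: (integrableB mtf intSv intSu).
have drop_ge0 : 0 <= Rintegral mu `[0, tf] drop.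
  rewrite (RintegralB mtf intSv intSu) subr_ge0.
  have := opt v cv; rewrite (mean_output_duality cu (st _ cu)).
  by rewrite (mean_output_duality cv (st _ cv)) lerD2l.
(* [loss t] is nonpositive at every sample and, for almost every [t], has mean [drop t]. A
   nonnegative time integral thus forces [drop] to vanish almost everywhere, and then [loss t] to
   vanish almost surely. *)
pose loss t w := Num.min (gain u tf S c t w) 0.
have lossP : {ae mu, forall t, `[0, tf]%classic t ->
    P.-integrable setT (EFin \o loss t) /\ mean P (loss t) = drop t}.
  have := ae_vec_integrable mtf (vec_integrable_control_tf cu).
  have := ae_vec_integrable mtf (vec_integrable_control_tf cv).
  apply: filterS2 => t intv intu t0tf.
  have [iv mv] := expect_mulmx (S t) 0 (intv t0tf).
  have [iu mu_] := expect_mulmx (S t) 0 (intu t0tf).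
  have -> : loss t = fun w => (S t *m v t w) 0 0 - (S t *m u t w) 0 0.
    by apply/funext => w; rewrite modified_controlB.
  split; first exact: (integrableB measurableT iv iu).
  rewrite /drop -mv -mu_ mean_integral; exact: (RintegralB measurableT iv iu).
have loss_le0 t w : loss t w <= 0 by rewrite /loss ge_min lexx orbT.
have drop_le0 : {ae mu, forall t, `[0, tf]%classic t -> drop t <= 0}.
  apply: lebesgue_ae_mono lossP => t lossPt /lossPt[il <-].
  have i0 : P.-integrable setT (EFin \o cst (0 : R)) by exact: integrable0.
  rewrite mean_integral (le_trans (le_Rintegral measurableT il i0 _))//.
  by rewrite Rintegral_cst// mul0r.
have drop0 := ae_eq0_of_nonpos mtf intdrop drop_le0 drop_ge0.
have good : {ae mu, forall t, `[0, tf]%classic t ->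
    {ae P, forall w, 0 <= (S t *m (c - u t w)) 0 0}}.
  apply: lebesgue_ae_mono2 lossP drop0 => t lossPt drop0t t0tf.
  have [il ml] := lossPt t0tf.
  have l0 : 0 <= Rintegral P setT (loss t).
    by move: ml; rewrite mean_integral (drop0t t0tf) /Rintegral => ->.
  have := ae_eq0_of_nonpos measurableT il (aeW P (fun w _ => loss_le0 t w)) l0.
  apply: filterS => w /(_ I); rewrite /loss /gain t0tf.
  by rewrite leNgt; case: ltP => // lt0 l0w; move: lt0; rewrite l0w ltxx.
exact: good.
Qed.

End maximum_principle.

(** * Maximizing a linear form over a rectangle *)

Section bang_bang.
Context {R : realType} {m k d : nat} {d0 : measure_display}
  {Omega : measurableType d0}.
Variables (P : probability Omega R) (lo hi : 'cV[R]_k).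
Notation mu := (@lebesgue_measure R).

Definition corner (s : {ffun 'I_k -> bool}) : 'cV[R]_k :=
  \col_j if s j then hi j 0 else lo j 0.

Lemma rectangle_corner (s : {ffun 'I_k -> bool}) :
  (forall i, lo i 0 <= hi i 0) -> rectangle lo hi (corner s).
Proof. by move=> lohi i; rewrite mxE; case: (s i); rewrite lexx lohi. Qed.

(** The corner maximizes each product [a 0 j * v j 0] separately, so every term of the sum is
    nonnegative. A nonpositive sum makes each term vanish, and [a 0 i != 0] then fixes [v i 0]. *)
Lemma linear_maximum_corner (a : 'rV[R]_k) (v : 'cV[R]_k) i :
  rectangle lo hi v ->
  (a *m (corner [ffun j => 0 <= a 0 j] - v)) 0 0 <= 0 ->
  a 0 i != 0 -> v i 0 = lo i 0 \/ v i 0 = hi i 0.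
Proof.
move=> v_rect; rewrite mxE => sum_le0 ai0.
pose term j := a 0 j * (corner [ffun j => 0 <= a 0 j] - v) j 0.
have termE j : term j = a 0 j * ((if 0 <= a 0 j then hi j 0 else lo j 0) - v j 0).
  by rewrite /term 3!mxE ffunE.
have term_ge0 j : 0 <= term j.
  rewrite termE; have /andP[lov vhi] := v_rect j.
  case: (leP 0 (a 0 j)) => aj; first by rewrite mulr_ge0// subr_ge0.
  by apply: mulr_le0; [exact: ltW|rewrite subr_le0].
have /eqP : \sum_j term j = 0.
  by apply/eqP; rewrite eq_le sum_le0 sumr_ge0.
rewrite psumr_eq0// => /allP/(_ i (mem_index_enum _))/=.
rewrite termE mulf_eq0 (negbTE ai0)/= subr_eq0 => /eqP <-.
by case: ifP; [right|left].
Qed.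

End bang_bang.

Theorem theorem5p3 (R : realType) (m k d : nat)
  (d0 : measure_display) (Omega : measurableType d0) (P : probability Omega R)
  (W : 'I_d -> R -> Omega -> R) (pb : problem R m k d)
  (X : (R -> Omega -> 'cV[R]_k) -> R -> Omega -> 'cV[R]_m)
  (Y : (R -> Omega -> 'cV[R]_k) -> R -> Omega -> R)
  (ubar : R -> Omega -> 'cV[R]_k)
  (P_complete : measure_is_complete P)
  (W_brownian : standard_brownian P W)
  (pb_standing : standing pb)
  (XY_state : forall u, control pb P W u -> state_eq pb P W u (X u) (Y u))
  (hA1 : A1 pb) (hA2 : A2 pb) (hA3 : A3 pb)
  (ubar_optimal : optimal pb P W Y ubar)
  (hA4 : A4 pb P ubar (X ubar) (Y ubar))
  (tau_lt_T : tau pb P (Y ubar) < horizon pb) :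
  let tf := tau pb P (Y ubar) in
  let den := (KX pb *m expect P (X ubar tf) + KU pb *m expect P (ubar tf)) 0 0 in
  (forall p : R -> 'cV[R]_m, costate pb tf p <->
     (forall t, t \in `[0, tf] -> (p t)^T = costate_formula pb tf t)) /\
  forall p0 : R -> 'cV[R]_m, costate pb tf p0 ->
  (forall u : 'cV[R]_k, U pb u ->
     {ae @lebesgue_measure R, forall t, t \in `[0, tf] ->
       {ae P, forall w,
         (switch_num pb p0 t *m (u - ubar t w)) 0 0 / den <= 0}}) /\
  (forall lo hi : 'cV[R]_k, (forall i, lo i 0 <= hi i 0) ->
     U pb = rectangle lo hi -> den != 0 ->
     forall i : 'I_k,
     {ae @lebesgue_measure R, forall t, t \in `[0, tf] ->
       ~ singular_time pb den p0 i t ->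
       {ae P, forall w, ubar t w i 0 = lo i 0 \/ ubar t w i 0 = hi i 0}}).
Proof.
move=> tf den.
have [[T0 y00 _] _] := pb_standing.
have [cubar tau_opt] := ubar_optimal.
have [lebG G_neq0] := hA4.
have meanY v t : control pb P W v -> t \in `[0, horizon pb] ->
    ('E_P[Y v t] = (mean P (Y v t))%:E)%E.
  move=> cv t0T; apply: meanE.
  exact: (integrable_output P_complete W_brownian cv (XY_state _ cv) t0T).
have cmeanY v (cv : control pb P W v) :=
  continuous_mean_output P_complete W_brownian cv (XY_state _ cv).
have meanY0 v : control pb P W v -> mean P (Y v 0) = y0 pb.
  move=> cv; have h0 : 0 \in `[0, horizon pb] by rewrite in_itv/= lexx ltW.
  rewrite (mean_output P_complete W_brownian cv (XY_state _ cv) h0).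
  by rewrite set_itv1 Rintegral_set1 addr0.
have tf_ge0 : 0 <= tf by exact: (tau_ge0 _ _ T0).
have tf0T : tf \in `[0, horizon pb] by rewrite in_itv/= tf_ge0 ltW.
have tf_le v : control pb P W v -> tf <= tau pb P (Y v).
  (* The real [inf] is a lower bound only for sets bounded below; here 0 bounds all hitting
     times. *)
  move=> cv; rewrite /tf tau_opt; apply: ge_inf; last by exists v.
  by exists 0 => _ [v' _ <-]; exact: (tau_ge0 _ _ T0).
have mean_tf_le0 : mean P (Y ubar tf) <= 0.
  exact: (mean_at_tau_le0 T0 (fun t => meanY ubar t cubar) (cmeanY _ cubar)).
(* At [t = tf] this gives the optimality of [ubar] for the final mean; before [tf], applied to
   [ubar], it gives the comparison used at the Lebesgue point. *)
have mean_ge0 v t : control pb P W v -> 0 <= t <= tf -> 0 <= mean P (Y v t).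
  move=> cv /andP[t0 ttf]; rewrite leNgt; apply/negP => Yv_lt0.
  have t0T : t \in `[0, horizon pb] by rewrite in_itv/= t0 (le_trans ttf) ?ltW.
  have := tau_lt_hit T0 (fun t => meanY v t cv) (cmeanY v cv) t0T.
  rewrite meanY0// => /(_ y00 Yv_lt0).
  by rewrite ltNge (le_trans ttf (tf_le v cv)).
have mean_tf0 : mean P (Y ubar tf) = 0.
  by apply/eqP; rewrite eq_le mean_tf_le0 mean_ge0// tf_ge0 lexx.
(* Averages at a Lebesgue point are two-sided, so [tf] has to be interior to the horizon. *)
have tf_gt0 : 0 < tf.
  rewrite lt_neqAle tf_ge0 andbT; apply/eqP => tf00.
  by move: mean_tf_le0; rewrite -tf00 meanY0// leNgt y00.
have den_lt0 : den < 0.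
  rewrite lt_neqAle G_neq0 /=.
  apply: (@lebesgue_pt_le0 _ (horizon pb) (y0 pb) _
    (fun t => mean P (Y ubar t)) tf _ _ _ _ lebG).
  - exact: (integrable_G cubar (XY_state _ cubar)).
  - move=> t.
    exact: (mean_output P_complete W_brownian cubar (XY_state _ cubar)).
  - by rewrite tf_gt0.
  - move=> t /andP[t0 ttf]; rewrite mean_tf0; apply: mean_ge0 => //.
    by rewrite t0 ltW.
have maximum p0 u : costate pb tf p0 -> U pb u ->
  {ae @lebesgue_measure R, forall t, t \in `[0, tf] -> {ae P, forall w,
      (switch_num pb p0 t *m (u - ubar t w)) 0 0 / den <= 0}}.
  move=> cp Uu; have opt v : control pb P W v ->
      mean P (Y ubar tf) <= mean P (Y v tf).
    by move=> cv; rewrite mean_tf0 mean_ge0// tf_ge0 lexx.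
  apply: lebesgue_ae_mono (switch_num_ge0 P_complete W_brownian tf_ge0
    (ltW tau_lt_T) cp XY_state cubar opt Uu) => t good t0tf.
  have := good t0tf; apply: filterS => w gain_ge0.
  by rewrite mulr_ge0_le0// invr_le0 ltW.
split=> [p|p0 cp]; first split.
- by move=> cp t; exact: formula_of_costate.
- exact: costate_of_formula.
split=> [u Uu|lo hi lohi UE den0 i]; first exact: maximum.
(* The corner used below depends on [t], whereas the null set in [maximum] depends on the chosen
   point; as there are finitely many corners, a common null set exists. *)
have corners : {ae @lebesgue_measure R, forall t, forall s, t \in `[0, tf] ->
    {ae P, forall w,
      (switch_num pb p0 t *m (corner lo hi s - ubar t w)) 0 0 / den <= 0}}.
  apply: lebesgue_ae_forall => s; apply: maximum => //.
  by rewrite UE; exact: rectangle_corner.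
apply: lebesgue_ae_mono corners => t corner_t t0tf nsing.
(* The signs are those of the switching function with the factor [den^-1] included, so dividing by
   the negative [den] needs no separate treatment. *)
have := corner_t [ffun j => 0 <= (den^-1 *: switch_num pb p0 t) 0 j] t0tf.
apply: filterS => w le0.
apply: (@linear_maximum_corner _ _ lo hi (den^-1 *: switch_num pb p0 t)).
- rewrite -UE; have [uU _] := cubar; apply: uU.
  by move: t0tf; rewrite !in_itv/= => /andP[-> /le_trans->]//; exact: ltW.
- by rewrite -scalemxAl mxE mulrC.
- by apply/eqP.
Qed.
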